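(* Let $d\ge 2$, let $x_1,\dots,x_n\in\mathbb{S}^{d-1}$ and $\alpha_1,\dots,\alpha_n>0$. Then $$\int_{\mathbb{B}^d}\left|\sum_{k=1}^n \alpha_k\frac{x_k-x}{|x_k-x|^d}\right|\,dm(x)\ \ge\ c_d\,\frac{\sum_{k=1}^n\alpha_k^{1+\frac{2}{d}}}{\sum_{k=1}^n\alpha_k^{\frac{2}{d}}},$$ where $c_d>0$ is a constant depending only on $d$ (not on $n$, the points $x_k$, or the weights $\alpha_k$).
   Context: $\mathbb{S}^{d-1}$ and $\mathbb{B}^d$ denote the unit sphere and the open unit ball of $\mathbb{R}^d$; $m$ is Lebesgue measure on $\mathbb{R}^d$; $|\cdot|$ is the Euclidean norm. *)

(* Defs.v *)
From HB Require Import structures.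
From mathcomp Require Import all_boot all_order all_algebra.
From mathcomp Require Import all_classical all_reals all_analysis.
Set Implicit Arguments. Unset Strict Implicit. Unset Printing Implicit Defensive.
Import Order.TTheory GRing.Theory Num.Theory.
Local Open Scope ring_scope.

Definition enorm (R : realType) (d : nat) (v : 'rV[R]_d) : R :=
  Num.sqrt (\sum_(i < d) v ord0 i ^+ 2).

(* Integral over R^d w.r.t. d-dimensional Lebesgue measure, written as the
   iterated integral of 1-dimensional Lebesgue integrals (for nonnegative
   measurable integrands this equals the integral against the product
   Lebesgue measure m on R^d, by Tonelli). *)
Fixpoint lebesgue_int_Rd (R : realType) (d : nat) :
    ('rV[R]_d -> \bar R) -> \bar R :=
  match d with
  | 0 => fun F => F 0
  | d'.+1 => fun F =>
      (\int[@lebesgue_measure R]_(t in [set: R])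
         lebesgue_int_Rd (fun v : 'rV[R]_d' => F (row_mx (\row_(j < 1) t) v)))%E
  end.

Definition in_open_ball (R : realType) (d : nat) (x : 'rV[R]_d) : bool :=
  enorm x < 1.

Definition field_sum (R : realType) (d n : nat) (xs : 'I_n -> 'rV[R]_d)
    (alpha : 'I_n -> R) (x : 'rV[R]_d) : 'rV[R]_d :=
  \sum_(k < n) (alpha k / enorm (xs k - x) ^+ d) *: (xs k - x).

(* Main.v *)
Require Import Defs.
From HB Require Import structures.
From mathcomp Require Import all_boot all_order all_algebra.
From mathcomp Require Import all_classical all_reals all_analysis.
From mathcomp Require Import measurable_realfun ring lra.
Import Order.TTheory GRing.Theory Num.Theory.
Import numFieldNormedType.Exports.
Local Open Scope ring_scope.

(** Write [F] for the field and fix radii [r k <= 1].  Let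
    [bump k x = (r k ^ 2 / (r k ^ 2 + |x - x_k| ^ 2)) ^ d],
    [cutoff = H / (1 + H)] with [H = \sum_k bump k], and
    [eta = s ^ 2 - |x| ^ 2] on the ball of radius [s < 1].  Since
    [eta <= 2 |x - x_k|] and [|grad (bump k)| <= 2 d bump k / |x - x_k|], the
    vector field [eta * grad cutoff] is bounded by a constant depending on [d]
    only, however much the bumps overlap.  As [div F = 0] in the ball, the
    divergence theorem for [eta * cutoff * F] bounds
    [\int cutoff * 2 (x . F)] by a multiple of [\int |F|], and on the unit
    ball
      [2 (x . F) = \sum_k alpha_k ((1 - |x|^2) / |x - x_k|^d - |x - x_k|^(2-d))].
    The first (Poisson) part contributes at least [c1 \sum_k alpha_k r_k], the
    second (Riesz) part at most [c2 (\sum_k alpha_k) (\sum_k r_k ^ 2)].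
    Choosing [r_k] proportional to [alpha_k / \sum_j alpha_j] gives the lower
    bound [c \sum_k alpha_k ^ 2 / \sum_k alpha_k], which dominates the one
    stated by Chebyshev's sum inequality. *)

(** * Iterated Lebesgue integrals *)

Section IteratedIntegral.
Context {R : realType}.

Definition cons_row n (t : R) (v : 'rV[R]_n) : 'rV[R]_n.+1 :=
  row_mx (\row_(j < 1) t) v.

Lemma cons_row0 n (t : R) (v : 'rV[R]_n) : cons_row n t v ord0 ord0 = t.
Proof.
rewrite /cons_row /row_mx mxE; by case: splitP => [j|k] //=; rewrite mxE.
Qed.

Lemma cons_rowS n (t : R) (v : 'rV[R]_n) (j : 'I_n) :
  cons_row n t v ord0 (lift ord0 j) = v ord0 j.
Proof.
rewrite /cons_row /row_mx mxE; case: splitP => [i|k] /= ij.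
  by move: (ltn_ord i); rewrite -ij.
by congr (v _ _); apply/val_inj; move: ij; rewrite /= /bump add1n => -[].
Qed.

Lemma lebesgue_int_RdS n (F : 'rV[R]_n.+1 -> \bar R) :
  lebesgue_int_Rd F =
  (\int[@lebesgue_measure R]_t lebesgue_int_Rd (fun v => F (cons_row n t v)))%E.
Proof. by []. Qed.

(* Joint measurability in the parameter and all coordinates, phrased so that
   no sigma-algebra on ['rV_n] is needed. *)
Definition jointly_measurable d (T : measurableType d) n
    (F : T -> 'rV[R]_n -> \bar R) : Prop :=
  forall d' (U : measurableType d') (f : U -> T) (g : U -> 'I_n -> R),
    measurable_fun setT f -> (forall i, measurable_fun setT (g ^~ i)) ->
    measurable_fun setT (fun u => F (f u) (\row_i g u i)).

(** Absorbing the first coordinate into the parameter lowers the dimension by one; this is why the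
    parameter space in [jointly_measurable] is arbitrary. *)
Lemma jointly_measurable_cons d (T : measurableType d) n
    (F : T -> 'rV[R]_n.+1 -> \bar R) :
  jointly_measurable d T n.+1 F ->
  jointly_measurable _ (T * R)%type n (fun p v => F p.1 (cons_row n p.2 v)).
Proof.
move=> mF d' U f g mf mg.
(* [g'] puts the second component of the parameter back as the first coordinate. *)
pose g' u i := if unlift ord0 i is Some j then g u j else (f u).2.
rewrite (_ : (fun u => _) = (fun u => F (f u).1 (\row_i g' u i))).
  apply: mF; first exact: measurableT_comp mf.
  move=> i; rewrite /g'; case: unliftP => [j _|_] //.
  exact: measurableT_comp mf.
apply/funext => u; congr (F _ _); apply/rowP => i; rewrite [RHS]mxE /g'.
case: unliftP => [j ->|->]; first by rewrite cons_rowS mxE.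
by rewrite cons_row0.
Qed.

Lemma jointly_measurable_comp d (T : measurableType d) d2
    (T2 : measurableType d2) n (h : T2 -> T) (F : T -> 'rV[R]_n -> \bar R) :
  measurable_fun setT h -> jointly_measurable d T n F ->
  jointly_measurable _ T2 n (fun p => F (h p)).
Proof.
move=> mh mF d' U f g mf mg; apply: (mF _ _ (h \o f)) => //.
exact: measurableT_comp.
Qed.

Lemma lebesgue_int_Rd_ge0 n (F : 'rV[R]_n -> \bar R) :
  (forall v, 0 <= F v)%E -> (0 <= lebesgue_int_Rd F)%E.
Proof.
elim: n F => [|n IH] F F0 /=; first exact: F0.
by apply: integral_ge0 => t _; exact: IH.
Qed.

(** By induction on [n] for all [T] at once: the induction hypothesis treats the parameter enlarged
    by the first coordinate, which Tonelli's theorem then integrates out. *)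
Lemma measurable_lebesgue_int_Rd d (T : measurableType d) n
    (F : T -> 'rV[R]_n -> \bar R) :
  (forall t v, 0 <= F t v)%E -> jointly_measurable d T n F ->
  measurable_fun setT (fun t => lebesgue_int_Rd (F t)).
Proof.
elim: n d T F => [|n IH] d T F F0 mF.
  rewrite (_ : (fun t => _) = (fun t => F (id t) (\row_i 0))).
    by apply: mF => // i; exact: measurable_cst.
  by apply/funext => t /=; congr (F t _); apply/rowP => -[].
have := IH _ (T * R)%type (fun p v => F p.1 (cons_row n p.2 v)).
move=> /(_ (fun _ _ => F0 _ _) (jointly_measurable_cons _ _ _ _ mF)) mI.
apply: (measurable_fun_fubini_tonelli_F (m2 := @lebesgue_measure R) _ mI) => p.
exact: lebesgue_int_Rd_ge0.
Qed.

Definition coord_measurable n (F : 'rV[R]_n -> \bar R) : Prop :=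
  forall d (T : measurableType d) (g : T -> 'I_n -> R),
    (forall i, measurable_fun setT (g ^~ i)) ->
    measurable_fun setT (fun u => F (\row_i g u i)).

Lemma coord_measurable_cons n (F : 'rV[R]_n.+1 -> \bar R) :
  coord_measurable n.+1 F ->
  jointly_measurable _ R n (fun t v => F (cons_row n t v)).
Proof.
move=> mF.
(* A one-point parameter space makes [jointly_measurable_cons] applicable; composing with
   [t |-> (tt, t)] removes it. *)
have : jointly_measurable _ (unit * R)%type n
    (fun p v => F (cons_row n p.2 v)).
  by apply: (jointly_measurable_cons _ _ _ (fun _ => F)) => d U f g _; exact: mF.
by move/(jointly_measurable_comp _ _ _ _ _ (fun t : R => (tt, t))); apply;
  exact: pair1_measurable.
Qed.

Lemma jointly_measurable_slice d (T : measurableType d) n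
    (F : T -> 'rV[R]_n -> \bar R) (t : T) :
  jointly_measurable d T n F -> coord_measurable n (F t).
Proof. by move=> mF d' U g mg; apply: (mF _ _ (cst t)). Qed.

Lemma coord_measurable_slice n (F : 'rV[R]_n.+1 -> \bar R) t :
  coord_measurable n.+1 F -> coord_measurable n (fun v => F (cons_row n t v)).
Proof.
move=> /coord_measurable_cons mF; exact: (jointly_measurable_slice _ _ _ _ t mF).
Qed.

Lemma measurable_lebesgue_int_Rd_cons n (F : 'rV[R]_n.+1 -> \bar R) :
  (forall v, 0 <= F v)%E -> coord_measurable n.+1 F ->
  measurable_fun setT (fun t => lebesgue_int_Rd (fun v => F (cons_row n t v))).
Proof.
move=> F0 mF; apply: measurable_lebesgue_int_Rd => //.
exact: coord_measurable_cons.
Qed.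

Lemma le_lebesgue_int_Rd n (F G : 'rV[R]_n -> \bar R) :
  (forall v, 0 <= F v)%E -> coord_measurable n F -> coord_measurable n G ->
  (forall v, F v <= G v)%E -> (lebesgue_int_Rd F <= lebesgue_int_Rd G)%E.
Proof.
elim: n F G => [|n IH] F G F0 mF mG FG; first exact: FG.
have G0 v : (0 <= G v)%E by exact: le_trans (F0 v) (FG v).
rewrite !lebesgue_int_RdS; apply: ge0_le_integral => //.
- by move=> t _; exact: lebesgue_int_Rd_ge0.
- exact: measurable_lebesgue_int_Rd_cons.
- exact: measurable_lebesgue_int_Rd_cons.
- by move=> t _; apply: IH => //; exact: coord_measurable_slice.
Qed.

Lemma lebesgue_int_RdD n (F G : 'rV[R]_n -> \bar R) :
  (forall v, 0 <= F v)%E -> (forall v, 0 <= G v)%E ->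
  coord_measurable n F -> coord_measurable n G ->
  lebesgue_int_Rd (fun v => F v + G v)%E =
  (lebesgue_int_Rd F + lebesgue_int_Rd G)%E.
Proof.
elim: n F G => [|n IH] F G F0 G0 mF mG; first by [].
rewrite !lebesgue_int_RdS -ge0_integralD //.
- by apply: eq_integral => t _; apply: IH => //; exact: coord_measurable_slice.
- by move=> t _; exact: lebesgue_int_Rd_ge0.
- exact: measurable_lebesgue_int_Rd_cons.
- by move=> t _; exact: lebesgue_int_Rd_ge0.
- exact: measurable_lebesgue_int_Rd_cons.
Qed.

Lemma lebesgue_int_RdZ n (c : R) (F : 'rV[R]_n -> \bar R) :
  0 <= c -> (forall v, 0 <= F v)%E -> coord_measurable n F ->
  lebesgue_int_Rd (fun v => c%:E * F v)%E = (c%:E * lebesgue_int_Rd F)%E.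
Proof.
move=> c0; elim: n F => [|n IH] F F0 mF; first by [].
rewrite !lebesgue_int_RdS -ge0_integralZl_EFin //.
- by apply: eq_integral => t _; apply: IH => //; exact: coord_measurable_slice.
- by move=> t _; exact: lebesgue_int_Rd_ge0.
- exact: measurable_lebesgue_int_Rd_cons.
Qed.

(** Tonelli on [R * R] carries the outer integral past the first coordinate; with that coordinate
    frozen, the induction hypothesis carries it past the others. *)
Lemma lebesgue_int_Rd_tonelli n (F : R -> 'rV[R]_n -> \bar R) :
  (forall t v, 0 <= F t v)%E -> jointly_measurable _ R n F ->
  (\int[@lebesgue_measure R]_t lebesgue_int_Rd (F t))%E =
  lebesgue_int_Rd (fun v => \int[@lebesgue_measure R]_t F t v)%E.
Proof.
elim: n F => [|n IH] F F0 mF; first by [].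
pose I (p : R * R) := lebesgue_int_Rd (fun v => F p.1 (cons_row n p.2 v)).
transitivity (\int[@lebesgue_measure R]_s \int[@lebesgue_measure R]_t I (t, s))%E.
  apply: (fubini_tonelli (m1 := @lebesgue_measure R)
    (m2 := @lebesgue_measure R) I) => [|p]; last exact: lebesgue_int_Rd_ge0.
  apply: (measurable_lebesgue_int_Rd _ (R * R)%type n
    (fun p v => F p.1 (cons_row n p.2 v))) => //.
  exact: jointly_measurable_cons.
rewrite lebesgue_int_RdS; apply: eq_integral => s _ /=.
apply: (IH (fun t v => F t (cons_row n s v))) => //.
apply: (jointly_measurable_comp _ _ _ _ _ (fun t : R => (t, s)) _ _
          (jointly_measurable_cons _ _ _ _ mF)).
exact: pair2_measurable.
Qed.

Definition set_coord n (x : 'rV[R]_n) (i : 'I_n) (t : R) : 'rV[R]_n :=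
  \row_j (if j == i then t else x ord0 j).

Lemma set_coord_cons0 n (t s : R) (v : 'rV[R]_n) :
  set_coord n.+1 (cons_row n s v) ord0 t = cons_row n t v.
Proof.
apply/rowP => j; rewrite mxE; case: (unliftP ord0 j) => [k ->|->].
  by rewrite !cons_rowS.
by rewrite eqxx cons_row0.
Qed.

Lemma set_coord_consS n (t s : R) (v : 'rV[R]_n) (i : 'I_n) :
  set_coord n.+1 (cons_row n s v) (lift ord0 i) t =
  cons_row n s (set_coord n v i t).
Proof.
apply/rowP => j; rewrite mxE; case: (unliftP ord0 j) => [k ->|->].
  by rewrite !cons_rowS mxE (inj_eq lift_inj).
by rewrite !cons_row0.
Qed.

(** Coordinates before [i] are frozen by induction; once [i] is the first coordinate, Tonelli moves
    its integral innermost. This reduces the divergence theorem to integrals along lines. *)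
Lemma eq_lebesgue_int_Rd_lines n (i : 'I_n) (F G : 'rV[R]_n -> \bar R) :
  (forall v, 0 <= F v)%E -> (forall v, 0 <= G v)%E ->
  coord_measurable n F -> coord_measurable n G ->
  (forall x, \int[@lebesgue_measure R]_t F (set_coord n x i t) =
             \int[@lebesgue_measure R]_t G (set_coord n x i t))%E ->
  lebesgue_int_Rd F = lebesgue_int_Rd G.
Proof.
elim: n i F G => [[]//|n IH] i F G F0 G0 mF mG FG.
case: (unliftP ord0 i) => [j ij|i0].
  rewrite !lebesgue_int_RdS; apply: eq_integral => t _.
  apply: (IH j) => //; try exact: coord_measurable_slice.
  move=> x; have := FG (cons_row n t x); rewrite ij.
  under eq_integral do rewrite set_coord_consS.
  by move=> ->; apply: eq_integral => s _; rewrite set_coord_consS.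
rewrite !lebesgue_int_RdS.
rewrite !lebesgue_int_Rd_tonelli//; try exact: coord_measurable_cons.
congr lebesgue_int_Rd; apply/funext => v.
(* The first entry [0] of the base point is arbitrary, as [set_coord] overwrites it. *)
have := FG (cons_row n 0 v); rewrite i0.
under eq_integral do rewrite set_coord_cons0.
by move=> ->; apply: eq_integral => s _; rewrite set_coord_cons0.
Qed.

End IteratedIntegral.

(** * Integrals of nonnegative real functions *)

Section RealIntegrands.
Context {R : realType}.
Local Notation mu := (@lebesgue_measure R).

Definition rmeas n (f : 'rV[R]_n -> R) : Prop :=
  forall d (T : measurableType d) (g : T -> 'I_n -> R),
    (forall i, measurable_fun setT (g ^~ i)) ->
    measurable_fun setT (fun u => f (\row_i g u i)).

Lemma rmeas_EFin n (f : 'rV[R]_n -> R) :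
  rmeas n f -> coord_measurable n (fun v => (f v)%:E).
Proof.
move=> mf d T g mg; apply/measurable_EFinP; exact: mf.
Qed.

Lemma rmeas_cst n (c : R) : rmeas n (fun=> c).
Proof. by move=> d T g mg; exact: measurable_cst. Qed.

Lemma rmeas_coord n (i : 'I_n) : rmeas n (fun v => v ord0 i).
Proof.
move=> d T g mg; rewrite (_ : (fun u => _) = g ^~ i) //.
by apply/funext => u; rewrite mxE.
Qed.

Lemma rmeas_comp n (h : R -> R) (f : 'rV[R]_n -> R) :
  measurable_fun setT h -> rmeas n f -> rmeas n (fun v => h (f v)).
Proof. by move=> mh mf d T g mg; apply: (measurableT_comp mh); exact: mf. Qed.

Lemma rmeasD n (f g : 'rV[R]_n -> R) :
  rmeas n f -> rmeas n g -> rmeas n (fun v => f v + g v).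
Proof.
by move=> mf mg d T h mh; apply: measurable_funD; [exact: mf|exact: mg].
Qed.

Lemma rmeasM n (f g : 'rV[R]_n -> R) :
  rmeas n f -> rmeas n g -> rmeas n (fun v => f v * g v).
Proof.
by move=> mf mg d T h mh; apply: measurable_funM; [exact: mf|exact: mg].
Qed.

Lemma rmeas_sum n (I : Type) (s : seq I) (f : I -> 'rV[R]_n -> R) :
  (forall i, rmeas n (f i)) -> rmeas n (fun v => \sum_(i <- s) f i v).
Proof.
move=> mf d T h mh.
by apply: (measurable_sum s (h := fun i u => f i (\row_j h u j))) => i; exact: mf.
Qed.

Lemma rmeas_prod n (I : eqType) (s : seq I) (f : I -> 'rV[R]_n -> R) :
  (forall i, rmeas n (f i)) -> rmeas n (fun v => \prod_(i <- s) f i v).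
Proof.
move=> mf d T h mh.
by apply: (measurable_prod (h := fun i u => f i (\row_j h u j))) => i _; exact: mf.
Qed.

Lemma rmeasX n k (f : 'rV[R]_n -> R) :
  rmeas n f -> rmeas n (fun v => f v ^+ k).
Proof. by move=> mf d T h mh; apply: measurable_funX; exact: mf. Qed.

(** For nonnegative [f] the inverse is the real power with exponent [-1], also where [f] vanishes,
    so the measurability of [powR] applies. *)
Lemma rmeasV n (f : 'rV[R]_n -> R) :
  (forall v, 0 <= f v) -> rmeas n f -> rmeas n (fun v => (f v)^-1).
Proof.
move=> f0 mf; rewrite (_ : (fun v => (f v)^-1) = (fun v => f v `^ (-1))).
  by apply: (rmeas_comp n (fun a => a `^ (-1)) f) => //; exact: measurable_powR.
by apply/funext => v; rewrite powR_inv1.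
Qed.

Lemma rmeas_sqrt n (f : 'rV[R]_n -> R) :
  (forall v, 0 <= f v) -> rmeas n f -> rmeas n (fun v => Num.sqrt (f v)).
Proof.
move=> f0 mf; rewrite (_ : (fun v => Num.sqrt (f v)) = (fun v => f v `^ 2^-1)).
  by apply: (rmeas_comp n (fun a => a `^ 2^-1) f) => //; exact: measurable_powR.
by apply/funext => v; rewrite powR12_sqrt.
Qed.

Lemma rmeas_iflt n (a b f : 'rV[R]_n -> R) :
  rmeas n a -> rmeas n b -> rmeas n f ->
  rmeas n (fun v => if a v < b v then f v else 0).
Proof.
move=> ma mb mf d T h mh; apply: measurable_fun_ifT.
- by apply: measurable_fun_ltr; [exact: ma|exact: mb].
- exact: mf.
- exact: measurable_cst.
Qed.

Lemma rmeas_enorm n (f : 'rV[R]_n -> 'rV[R]_n) :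
  (forall i, rmeas n (fun v => f v ord0 i)) -> rmeas n (fun v => enorm (f v)).
Proof.
move=> mf; apply: rmeas_sqrt; first by move=> v; apply: sumr_ge0 => i _; exact: sqr_ge0.
by apply: rmeas_sum => i; exact: rmeasX.
Qed.

Lemma le_rint n (f g : 'rV[R]_n -> R) :
  (forall v, 0 <= f v) -> rmeas n f -> rmeas n g -> (forall v, f v <= g v) ->
  (lebesgue_int_Rd (fun v => (f v)%:E) <= lebesgue_int_Rd (fun v => (g v)%:E))%E.
Proof.
move=> f0 mf mg fg; apply: le_lebesgue_int_Rd.
- by move=> v; rewrite lee_fin.
- exact: rmeas_EFin.
- exact: rmeas_EFin.
- by move=> v; rewrite lee_fin.
Qed.

Lemma rintD n (f g : 'rV[R]_n -> R) :
  (forall v, 0 <= f v) -> (forall v, 0 <= g v) -> rmeas n f -> rmeas n g ->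
  lebesgue_int_Rd (fun v => (f v + g v)%:E) =
  (lebesgue_int_Rd (fun v => (f v)%:E) + lebesgue_int_Rd (fun v => (g v)%:E))%E.
Proof.
move=> f0 g0 mf mg; rewrite -lebesgue_int_RdD //; try exact: rmeas_EFin;
  by move=> v; rewrite lee_fin.
Qed.

Lemma rintZ n (c : R) (f : 'rV[R]_n -> R) :
  0 <= c -> (forall v, 0 <= f v) -> rmeas n f ->
  lebesgue_int_Rd (fun v => (c * f v)%:E) =
  (c%:E * lebesgue_int_Rd (fun v => (f v)%:E))%E.
Proof.
move=> c0 f0 mf; rewrite -lebesgue_int_RdZ //; exact: rmeas_EFin.
Qed.

Lemma rint0 n : lebesgue_int_Rd (fun _ : 'rV[R]_n => (0 : R)%:E) = 0%E.
Proof.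
elim: n => //= n IH; apply: integral0_eq => t _; exact: IH.
Qed.

Lemma rint_sum n (I : Type) (s : seq I) (f : I -> 'rV[R]_n -> R) :
  (forall i v, 0 <= f i v) -> (forall i, rmeas n (f i)) ->
  lebesgue_int_Rd (fun v => (\sum_(i <- s) f i v)%:E) =
  (\sum_(i <- s) lebesgue_int_Rd (fun v => (f i v)%:E))%E.
Proof.
move=> f0 mf; elim: s => [|i s IH].
  by rewrite big_nil -[RHS](rint0 n); congr lebesgue_int_Rd;
    apply/funext => v; rewrite big_nil.
rewrite big_cons -IH -rintD //.
- by congr lebesgue_int_Rd; apply/funext => v; rewrite big_cons.
- by move=> v; exact: sumr_ge0.
- exact: rmeas_sum.
Qed.

Lemma rint_prod_coord n (g : 'I_n -> R -> R) (c : 'I_n -> R) :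
  (forall i t, 0 <= g i t) -> (forall i, measurable_fun setT (g i)) ->
  (forall i, \int[mu]_t (g i t)%:E = (c i)%:E)%E ->
  lebesgue_int_Rd (fun v => (\prod_(i < n) g i (v ord0 i))%:E) =
  (\prod_(i < n) c i)%:E.
Proof.
elim: n g c => [|n IH] g c g0 mg gc; first by rewrite /= !big_ord0.
rewrite lebesgue_int_RdS.
transitivity (\int[mu]_t ((\prod_(i < n) c (lift ord0 i))%:E * (g ord0 t)%:E))%E.
  apply: eq_integral => t _; rewrite muleC -(IH (fun i => g (lift ord0 i)) _) // -rintZ //.
  - congr lebesgue_int_Rd; apply/funext => v; rewrite big_ord_recl cons_row0.
    by congr (_%:E); congr (_ * _); apply: eq_bigr => i _; rewrite cons_rowS.
  - by move=> v; exact: prodr_ge0.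
  - apply: rmeas_prod => i; apply: rmeas_comp => //; exact: rmeas_coord.
have c0 i : 0 <= c i.
  by rewrite -lee_fin -gc; apply: integral_ge0 => t _; rewrite lee_fin.
rewrite ge0_integralZl_EFin //.
- by rewrite gc -EFinM big_ord_recl mulrC.
- by move=> t _; rewrite lee_fin.
- apply/measurable_EFinP; exact: mg.
- exact: prodr_ge0.
Qed.

(** The bound makes every one-variable integral finite, so [rint_prod_coord] applies to their real
    values. *)
Lemma rint_prod_coord_le n (g : 'I_n -> R -> R) (c : R) :
  (forall i t, 0 <= g i t) -> (forall i, measurable_fun setT (g i)) ->
  (forall i, \int[mu]_t (g i t)%:E <= c%:E)%E ->
  (lebesgue_int_Rd (fun v => (\prod_(i < n) g i (v ord0 i))%:E) <= (c ^+ n)%:E)%E.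
Proof.
move=> g0 mg gc.
pose J i := (\int[mu]_t (g i t)%:E)%E.
have J0 i : (0 <= J i)%E by apply: integral_ge0 => t _; rewrite lee_fin.
have Jfin i : J i \is a fin_num by rewrite ge0_fin_numE //; exact: le_lt_trans (gc i) (ltry _).
rewrite (rint_prod_coord _ _ (fun i => fine (J i))) //; last first.
  by move=> i; rewrite fineK.
rewrite lee_fin -[X in _ <= _ ^+ X](card_ord n) -prodr_const.
apply: ler_prod => i _; rewrite fine_ge0 //= -lee_fin fineK //; exact: gc.
Qed.

Lemma FTC_is_derive (f F : R -> R) (a b : R) : a < b ->
  (forall t, a <= t <= b -> is_derive t 1 F (f t)) ->
  (forall t, a <= t <= b -> {for t, continuous f}) ->
  (\int[mu]_(t in `[a, b]%classic) (f t)%:E = (F b - F a)%:E)%E.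
Proof.
move=> ab dF cf.
have cF t : a <= t <= b -> {for t, continuous F}.
  move=> tab; apply: differentiable_continuous; apply/derivable1_diffP.
  by case: (dF _ tab).
rewrite EFinB; apply: continuous_FTC2 => //.
- apply: continuous_in_subspaceT => t; rewrite inE /= in_itv /=; exact: cf.
- split.
  + move=> t; rewrite in_itv /= => /andP[at' tb].
    by case: (dF t _) => //; rewrite !ltW.
  + by apply: cvg_at_right_filter; apply: cF; rewrite lexx ltW.
  + by apply: cvg_at_left_filter; apply: cF; rewrite lexx ltW.
- move=> t; rewrite in_itv /= => /andP[at' tb]; rewrite derive1E.
  by case: (dF t _) => //; rewrite !ltW.
Qed.

End RealIntegrands.

(** * Euclidean norm, partial derivatives and integrals along lines *)

Section EuclideanNorm.
Context {R : realType} {n : nat}.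
Implicit Types x y : 'rV[R]_n.

Lemma sumsq_ge0 x : 0 <= \sum_(i < n) x ord0 i ^+ 2.
Proof. by apply: sumr_ge0 => i _; exact: sqr_ge0. Qed.

Lemma enorm_ge0 x : 0 <= enorm x.
Proof. exact: sqrtr_ge0. Qed.

Lemma enorm0 : enorm (0 : 'rV[R]_n) = 0.
Proof. by rewrite /enorm big1 ?sqrtr0 // => j _; rewrite mxE expr0n. Qed.

Lemma sqr_enorm x : enorm x ^+ 2 = \sum_(i < n) x ord0 i ^+ 2.
Proof. by rewrite sqr_sqrtr // sumsq_ge0. Qed.

Lemma normr_coord_le x i : `|x ord0 i| <= enorm x.
Proof.
rewrite -sqrtr_sqr ler_sqrt ?sumsq_ge0 // (bigD1 i) //= lerDl.
by apply: sumr_ge0 => j _; exact: sqr_ge0.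
Qed.

Lemma enorm_le_sum x : enorm x <= \sum_(i < n) `|x ord0 i|.
Proof.
have S0 : 0 <= \sum_(i < n) `|x ord0 i| by exact: sumr_ge0.
rewrite -(ler_pXn2r (ltn0Sn 1)) ?nnegrE ?enorm_ge0 // sqr_enorm expr2 mulr_suml.
apply: ler_sum => i _; rewrite -real_normK ?num_real // expr2 ler_wpM2l //.
by rewrite (bigD1 i) //= lerDl; exact: sumr_ge0.
Qed.

Lemma enorm_eq0_coord x i : enorm x = 0 -> x ord0 i = 0.
Proof.
by move=> x0; apply/eqP; rewrite -normr_le0 -x0; exact: normr_coord_le.
Qed.

(** The sum of the squares of [|y| x_i - |x| y_i] equals [2 |x| |y| (|x| |y| - x . y)]. The factor
    [|x| |y|] is cancelled when positive; otherwise one of the vectors is zero. *)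
Lemma cauchy_schwarz_enorm x y :
  \sum_(i < n) x ord0 i * y ord0 i <= enorm x * enorm y.
Proof.
have [xy0|] := eqVneq (enorm x * enorm y) 0.
  rewrite xy0; move/eqP: xy0; rewrite mulf_eq0 => /orP[|] /eqP h;
  by rewrite big1 // => i _; rewrite (enorm_eq0_coord _ _ h) ?mul0r ?mulr0.
move=> xyN0; have xy_gt0 : 0 < enorm x * enorm y.
  by rewrite lt_neqAle eq_sym xyN0 mulr_ge0 // enorm_ge0.
have : 0 <= \sum_(i < n) (enorm y * x ord0 i - enorm x * y ord0 i) ^+ 2.
  by apply: sumr_ge0 => i _; exact: sqr_ge0.
rewrite (eq_bigr (fun i => enorm y ^+ 2 * x ord0 i ^+ 2
  - 2 * (enorm x * enorm y) * (x ord0 i * y ord0 i)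
  + enorm x ^+ 2 * y ord0 i ^+ 2)); last by move=> i _; ring.
rewrite big_split sumrB /= -!mulr_sumr -!sqr_enorm.
set u := \sum_(i < n) _ => h.
rewrite -(ler_pM2l xy_gt0) -subr_ge0; move: h.
rewrite (_ : _ + _ = 2 * (enorm x * enorm y * (enorm x * enorm y)
  - enorm x * enorm y * u)); last by ring.
by rewrite pmulr_rge0.
Qed.

Lemma enormD x y : enorm (x + y) <= enorm x + enorm y.
Proof.
rewrite -(ler_pXn2r (ltn0Sn 1)) ?nnegrE ?addr_ge0 ?enorm_ge0 // sqr_enorm.
rewrite (eq_bigr (fun i => x ord0 i ^+ 2 + 2 * (x ord0 i * y ord0 i)
  + y ord0 i ^+ 2)); last by move=> i _; rewrite mxE; ring.
rewrite !big_split /= -!sqr_enorm -mulr_sumr.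
have := cauchy_schwarz_enorm x y; set u := \sum_(i < n) _; nra.
Qed.

Lemma enormN x : enorm (- x) = enorm x.
Proof. by congr Num.sqrt; apply: eq_bigr => i _; rewrite mxE sqrrN. Qed.

Lemma enormZ (a : R) x : 0 <= a -> enorm (a *: x) = a * enorm x.
Proof.
move=> a0; rewrite -[a in RHS]ger0_norm // -sqrtr_sqr /enorm -sqrtrM ?sqr_ge0 //.
by rewrite mulr_sumr; congr Num.sqrt; apply: eq_bigr => i _; rewrite mxE exprMn.
Qed.

Lemma enorm_sub_ge x y : enorm x - enorm y <= enorm (x - y).
Proof. by rewrite lerBlDr -{1}(subrK y x) enormD. Qed.

Lemma enormB x y : enorm (x - y) = enorm (y - x).
Proof. by rewrite -enormN opprB. Qed.

End EuclideanNorm.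

(** * Calculus of partial derivatives along coordinate lines *)

Section PartialDerivatives.
Context {R : realType} {n : nat}.
Implicit Types (x : 'rV[R]_n) (f g : 'rV[R]_n -> R).

Lemma set_coord_id x i : set_coord n x i (x ord0 i) = x.
Proof. by apply/rowP => j; rewrite mxE; case: eqP => [->|]. Qed.

Lemma set_coord_set x i s t : set_coord n (set_coord n x i s) i t = set_coord n x i t.
Proof. by apply/rowP => j; rewrite !mxE; case: eqP. Qed.

Lemma set_coordE x i t : set_coord n x i t ord0 i = t.
Proof. by rewrite mxE eqxx. Qed.

(** A relation with the value as an argument, so that derivatives are assembled by composing the
    rules below and the value is adjusted at the end by [pder_eq]. *)
Definition pder f x i (l : R) : Prop :=
  is_derive (x ord0 i) (1 : R) (fun t : R => f (set_coord n x i t) : R) l.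

Definition pcont f x i : Prop :=
  {for x ord0 i, continuous (fun t : R => f (set_coord n x i t) : R)}.

(** Moving the base point along the line does not change the one-variable function being
    differentiated. *)
Lemma pder_line f x i t l : pder f (set_coord n x i t) i l ->
  is_derive t (1 : R) (fun t : R => f (set_coord n x i t) : R) l.
Proof.
rewrite /pder set_coordE; congr (is_derive _ _ _ _).
by apply/funext => u; rewrite set_coord_set.
Qed.

Lemma pcont_line f x i t : pcont f (set_coord n x i t) i ->
  {for t, continuous (fun t : R => f (set_coord n x i t) : R)}.
Proof.
rewrite /pcont set_coordE (_ : (fun u => f (set_coord n (set_coord n x i t) i u)) =
  (fun u => f (set_coord n x i u))) //.
by apply/funext => u; rewrite set_coord_set.
Qed.

Lemma pder_eq f x i l l' : pder f x i l -> l = l' -> pder f x i l'.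
Proof. by move=> h <-. Qed.

Lemma pder_cst x i (c : R) : pder (fun=> c) x i 0.
Proof. exact: is_derive_cst. Qed.

Lemma pder_coord x i j : pder (fun v => v ord0 j) x i (i == j)%:R.
Proof.
rewrite /pder; have [<-|ij] := eqVneq i j.
  rewrite (_ : (fun t => _) = id); first exact: is_derive_id.
  by apply/funext => t; rewrite set_coordE.
rewrite (_ : (fun t => _) = cst (x ord0 j)); first exact: is_derive_cst.
by apply/funext => t; rewrite mxE eq_sym (negbTE ij).
Qed.

Lemma pderD f g x i l m : pder f x i l -> pder g x i m ->
  pder (fun v => f v + g v) x i (l + m).
Proof. exact: is_deriveD. Qed.

Lemma pderN f x i l : pder f x i l -> pder (fun v => - f v) x i (- l).
Proof. exact: is_deriveN. Qed.

Lemma pderM f g x i l m : pder f x i l -> pder g x i m ->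
  pder (fun v => f v * g v) x i (f x * m + g x * l).
Proof.
by move=> hf hg; have := is_deriveM hf hg; rewrite /= set_coord_id.
Qed.

Lemma pder_sum m (f : 'I_m -> 'rV[R]_n -> R) x i (l : 'I_m -> R) :
  (forall k, pder (f k) x i (l k)) ->
  pder (fun v => \sum_(k < m) f k v) x i (\sum_(k < m) l k).
Proof.
move=> h; have := is_derive_sum h; rewrite /pder.
by rewrite (_ : \sum_(k < m) _ = fun t => \sum_(k < m) f k (set_coord n x i t)) //;
  apply/funext => t; rewrite fct_sumE.
Qed.

Lemma pderX k f x i l : pder f x i l ->
  pder (fun v => f v ^+ k) x i (k%:R * f x ^+ k.-1 * l).
Proof.
move=> h; have := is_deriveX k h; rewrite set_coord_id /pder.
rewrite (_ : (fun t : R => f (set_coord n x i t)) ^+ k =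
  (fun t => f (set_coord n x i t) ^+ k)) //.
elim: k => [|k IH]; first by rewrite expr0.
by rewrite exprS IH; apply/funext => t; rewrite exprS.
Qed.

Lemma pderV f x i l : f x != 0 -> pder f x i l ->
  pder (fun v => (f v)^-1) x i (- f x ^- 2 * l).
Proof.
move=> fx0 h; have := @is_deriveV R _ _ _ _ _ h.
by rewrite set_coord_id; exact.
Qed.

Lemma pder_sqrt f x i l : 0 < f x -> pder f x i l ->
  pder (fun v => Num.sqrt (f v)) x i ((2 * Num.sqrt (f x))^-1 * l).
Proof.
move=> fx0 h; apply: (is_derive1_comp (f := Num.sqrt)); last exact: h.
by rewrite set_coord_id; exact: is_derive1_sqrt.
Qed.

End PartialDerivatives.

(** * Functions that are bounded and regular on a closed ball *)

Section Tame.
Context {R : realType} {n : nat} (s : R).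
Implicit Types (x : 'rV[R]_n) (f g : 'rV[R]_n -> R).

(* What the fundamental theorem of calculus along lines and the integrals over
   the ball of radius [s] require of an integrand. *)
Definition tame f : Prop :=
  [/\ rmeas n f,
      exists M, forall x, enorm x <= s -> `|f x| <= M
    & forall x i, enorm x <= s -> pcont f x i].

Lemma tame_cst c : tame (fun=> c).
Proof.
split; [exact: rmeas_cst|by exists (`|c|)|].
by move=> x i _; exact: cvg_cst.
Qed.

Lemma tame_coord i : tame (fun v => v ord0 i).
Proof.
split; first exact: rmeas_coord.
  by exists s => x xs; exact: le_trans (normr_coord_le _ _) xs.
move=> x j _; apply: differentiable_continuous; apply/derivable1_diffP.
by case: (pder_coord x j i).
Qed.

Lemma tameD f g : tame f -> tame g -> tame (fun v => f v + g v).
Proof.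
move=> [mf [M fM] cf] [mg [L gL] cg]; split; first exact: rmeasD.
  exists (M + L) => x xs; apply: le_trans (ler_normD _ _) _.
  by rewrite lerD ?fM ?gL.
by move=> x i xs; apply: cvgD; [exact: cf|exact: cg].
Qed.

Lemma tameM f g : tame f -> tame g -> tame (fun v => f v * g v).
Proof.
move=> [mf [M fM] cf] [mg [L gL] cg]; split; first exact: rmeasM.
  by exists (M * L) => x xs; rewrite normrM ler_pM ?fM ?gL.
by move=> x i xs; apply: cvgM; [exact: cf|exact: cg].
Qed.

Lemma tameN f : tame f -> tame (fun v => - f v).
Proof.
move=> tf; have := tameM _ _ (tame_cst (-1)) tf.
by congr tame; apply/funext => v; rewrite mulN1r.
Qed.

Lemma tameX k f : tame f -> tame (fun v => f v ^+ k).
Proof.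
move=> tf; elim: k => [|k IH]; first exact: (tame_cst 1).
by under eq_fun do rewrite exprS; exact: tameM.
Qed.

Lemma tame_sum (I : Type) (r : seq I) (f : I -> 'rV[R]_n -> R) :
  (forall k, tame (f k)) -> tame (fun v => \sum_(k <- r) f k v).
Proof.
move=> tf; elim: r => [|k r IH].
  by under eq_fun do rewrite big_nil; exact: (tame_cst 0).
by under eq_fun do rewrite big_cons; exact: tameD.
Qed.

(** The lower bound [e] on the ball gives boundedness and continuity of the inverse; nonnegativity
    everywhere serves its measurability. *)
Lemma tameV (e : R) f : 0 < e -> (forall x, 0 <= f x) ->
  (forall x, enorm x <= s -> e <= f x) -> tame f -> tame (fun v => (f v)^-1).
Proof.
move=> e0 f0 fe [mf _ cf]; split; first exact: rmeasV.
  exists e^-1 => x xs; have fx := fe _ xs.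
  by rewrite ger0_norm ?invr_ge0 // lef_pV2 // posrE // (lt_le_trans e0).
move=> x i xs; apply: continuousV; last exact: cf.
by rewrite set_coord_id gt_eqF // (lt_le_trans e0) // fe.
Qed.

Lemma tame_sqrt f : (forall x, 0 <= f x) -> tame f ->
  tame (fun v => Num.sqrt (f v)).
Proof.
move=> f0 [mf [M fM] cf]; split; first exact: rmeas_sqrt.
  exists (Num.sqrt M) => x xs; rewrite ger0_norm ?sqrtr_ge0 //.
  by have := fM _ xs; rewrite ger0_norm // => fxM; rewrite ler_sqrt // (le_trans _ fxM).
move=> x i xs.
apply: (@continuous_comp _ _ _ (fun t : R => f (set_coord n x i t)) Num.sqrt).
  exact: cf.
exact: sqrt_continuous.
Qed.

End Tame.

(** * The fundamental theorem of calculus on the chords of a ball *)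

Section LineIntegral.
Context {R : realType} {n : nat}.
Local Notation mu := (@lebesgue_measure R).

Lemma sqr_enorm_set_coord (x : 'rV[R]_n) i t :
  enorm (set_coord n x i t) ^+ 2 = \sum_(j < n | j != i) x ord0 j ^+ 2 + t ^+ 2.
Proof.
rewrite sqr_enorm (bigD1 i) //= set_coordE addrC; congr (_ + _).
by apply: eq_bigr => j /negbTE ji; rewrite mxE ji.
Qed.

(** The line meets the ball in a chord of half-length [Num.sqrt a], or not at all when [a <= 0]. As
    [P] vanishes at both ends of the chord, [D] integrates to zero and only the constant [M]
    remains. That constant later serves to make integrands nonnegative. *)
Lemma line_integral_pder (s M : R) (P D : 'rV[R]_n -> R) (x : 'rV[R]_n) i :
  0 < s -> tame s D ->
  (forall y, enorm y <= s -> pder P y i (D y)) ->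
  (forall y, enorm y = s -> P y = 0) ->
  let a := s ^+ 2 - \sum_(j < n | j != i) x ord0 j ^+ 2 in
  (\int[mu]_t (if enorm (set_coord n x i t) < s
     then D (set_coord n x i t) + M else 0)%:E =
   (if 0 < a then 2 * Num.sqrt a * M else 0)%:E)%E.
Proof.
move=> s0 [mD _ cD] dP P0 a.
have ltE t : (enorm (set_coord n x i t) < s) = (t ^+ 2 < a).
  rewrite -(ltr_pXn2r (ltn0Sn 1)) ?nnegrE ?enorm_ge0 ?(ltW s0) //.
  by rewrite sqr_enorm_set_coord /a ltrBrDl.
have leE t : (enorm (set_coord n x i t) <= s) = (t ^+ 2 <= a).
  rewrite -(ler_pXn2r (ltn0Sn 1)) ?nnegrE ?enorm_ge0 ?(ltW s0) //.
  by rewrite sqr_enorm_set_coord /a lerBrDl.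
case: ltP => a0; last first.
  apply: integral0_eq => t _; rewrite ltE ltNge (le_trans a0) ?sqr_ge0 //.
pose q : R := Num.sqrt a; rewrite -/q.
have q0 : 0 < q by rewrite sqrtr_gt0.
have q2 : q ^+ 2 = a by rewrite sqr_sqrtr // ltW.
have le_q (t : R) : (t ^+ 2 <= a) = (- q <= t <= q).
  by rewrite -q2 -ler_norml -[RHS](ler_pXn2r (ltn0Sn 1)) ?nnegrE ?(ltW q0) // real_normK ?num_real.
have lt_q (t : R) : (t ^+ 2 < a) = (- q < t < q).
  by rewrite -q2 -ltr_norml -[RHS](ltr_pXn2r (ltn0Sn 1)) ?nnegrE ?(ltW q0) // real_normK ?num_real.
pose f t := D (set_coord n x i t) + M.
have mf : measurable_fun setT f.
  apply: measurable_funD; last exact: measurable_cst.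
  apply: (mD _ _ (fun t j => if j == i then t else x ord0 j)) => j.
  by case: eqP => _; [exact: measurable_id|exact: measurable_cst].
transitivity (\int[mu]_(t in [set` `]- q, q[%R]) (f t)%:E)%E.
  rewrite [RHS]integral_mkcond; apply: eq_integral => t _.
  rewrite patchE ltE lt_q mem_setE in_itv /=; by case: ifP.
have mfE : measurable_fun [set` `]- q, q[%R] (EFin \o f).
  by apply: measurable_funTS; apply/measurable_EFinP.
(* The end points, a null set, are added because the fundamental theorem is used on a closed
   interval. *)
rewrite -(integral_itv_bndoo true false mfE) /=.
have eqE t : t ^+ 2 = a -> enorm (set_coord n x i t) = s.
  by move=> ta; apply/eqP; rewrite eq_le leE [s <= _]leNgt ltE ta lexx ltxx.
pose F t := P (set_coord n x i t) + M * t.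
transitivity (F q - F (- q))%:E; last first.
  congr (_%:E); rewrite /F !P0; first ring.
    by apply: eqE; rewrite sqrrN.
  exact: eqE.
apply: FTC_is_derive.
- by rewrite (lt_trans _ q0) // oppr_lt0.
- move=> t; rewrite -le_q -leE => ts; apply: is_deriveD.
    by apply: pder_line; exact: dP.
  have := is_deriveZ M (is_derive_id t (1 : R)).
  by rewrite /GRing.scale /= mulr1.
- move=> t; rewrite -le_q -leE => ts; apply: cvgD; last exact: cvg_cst.
  by apply: pcont_line; exact: cD.
Qed.

End LineIntegral.

(** * One-dimensional integrals *)

Section OneDimensional.
Context {R : realType}.
Local Notation mu := (@lebesgue_measure R).

Lemma integral_if_itv (f : R -> R) (a b : R) :
  (\int[mu]_t (if a <= t <= b then f t else 0)%:E =
   \int[mu]_(t in [set` `[a, b]%R]) (f t)%:E)%E.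
Proof.
rewrite [RHS]integral_mkcond; apply: eq_integral => t _.
by rewrite patchE mem_setE in_itv /=; case: ifP.
Qed.

Lemma measurable_if_itv (f : R -> R) (a b : R) : measurable_fun setT f ->
  measurable_fun setT (fun t => if a <= t <= b then f t else 0).
Proof.
move=> mf; apply: measurable_fun_ifT => //.
by apply: measurable_and; apply: measurable_fun_ler.
Qed.

Lemma integral_itv_indicator (a b : R) : a < b ->
  (\int[mu]_t (if a <= t <= b then 1 else 0 : R)%:E = (b - a)%:E)%E.
Proof.
move=> ab; rewrite (integral_if_itv (fun=> 1)).
apply: (FTC_is_derive (fun=> 1) id) => // t _.
exact: cvg_cst.
Qed.

Lemma is_derive_powR_comp (e : R) (g : R -> R) (t l : R) : 0 < g t ->
  is_derive t 1 g l -> is_derive t 1 (fun u => g u `^ e) (e * g t `^ (e - 1) * l).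
Proof.
move=> g0 dg; apply: (is_derive1_comp (f := fun u => u `^ e)) => //.
exact: is_derive1_powR.
Qed.

Lemma is_derive_continuous (f : R -> R) (t l : R) :
  is_derive t 1 f l -> {for t, continuous f}.
Proof.
by move=> [df _]; apply: differentiable_continuous; apply/derivable1_diffP.
Qed.

Lemma is_derive_affine (m c t : R) : is_derive t 1 (fun u : R => m * u + c) m.
Proof.
have := is_deriveD (is_deriveZ m (is_derive_id t (1 : R))) (is_derive_cst c t (1 : R)).
by rewrite addr0 /GRing.scale /= mulr1.
Qed.

Lemma powR_affine_integral (e m c a b : R) : 0 < e -> m != 0 -> a < b ->
  (forall t, a <= t <= b -> 0 < m * t + c) ->
  (\int[mu]_t (if a <= t <= b then (m * t + c) `^ (e - 1) else 0)%:E =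
   (((m * b + c) `^ e - (m * a + c) `^ e) / (m * e))%:E)%E.
Proof.
move=> e0 m0 ab pos; rewrite integral_if_itv.
pose F t := (m * e)^-1 * (m * t + c) `^ e.
transitivity (F b - F a)%:E; last by congr (_%:E); rewrite /F; ring.
apply: FTC_is_derive => // t tab.
- have := is_deriveZ (m * e)^-1
    (is_derive_powR_comp e _ t _ (pos _ tab) (is_derive_affine m c t)).
  move/is_derive_eq; apply; rewrite /GRing.scale /=.
  by field; rewrite m0 gt_eqF.
- exact: is_derive_continuous (is_derive_powR_comp (e - 1) _ t _ (pos _ tab)
    (is_derive_affine m c t)).
Qed.

Lemma measurable_cauchy_kernel (r a : R) :
  measurable_fun setT (fun t : R => r ^+ 2 / (r ^+ 2 + (t - a) ^+ 2)).
Proof.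
apply: measurable_funM; first exact: measurable_cst.
rewrite (_ : (fun t => _) = (fun t : R => (r ^+ 2 + (t - a) ^+ 2) `^ (-1))); last first.
  by apply/funext => t; rewrite powR_inv1 // addr_ge0 // sqr_ge0.
apply: (measurableT_comp (measurable_powR (-1))).
apply: measurable_funD; first exact: measurable_cst.
by apply: measurable_funX; apply: measurable_funB.
Qed.

(** An antiderivative is [r atan ((t - a) / r)], and the arctangent varies by less than [pi]. *)
Lemma cauchy_kernel_integral_le (r a : R) : 0 < r ->
  (\int[mu]_t (if (-1 : R) <= t <= 1 then r ^+ 2 / (r ^+ 2 + (t - a) ^+ 2) else 0)%:E
   <= (pi * r)%:E)%E.
Proof.
move=> r0; rewrite integral_if_itv.
pose F t := r * atan (r^-1 * t + - (a / r)).
have q0 (t : R) : 0 < r ^+ 2 + (t - a) ^+ 2.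
  by rewrite ltr_pwDl ?exprn_gt0 // sqr_ge0.
rewrite [leLHS](_ : _ = (F 1 - F (-1))%:E).
  rewrite lee_fin /F -mulrBr mulrC ler_pM2r //.
  set u := atan _; set v := atan _.
  have : u < pi / 2 by exact: atan_ltpi2.
  have : - (pi / 2) < v by exact: atan_gtNpi2.
  lra.
apply: FTC_is_derive => //.
- move=> t _.
  have := is_deriveZ r (is_derive1_comp (g := fun u : R => r^-1 * u + - (a / r))
    (is_derive1_atan (r^-1 * t + - (a / r))) (is_derive_affine r^-1 (- (a / r)) t)).
  move/is_derive_eq; apply; rewrite /GRing.scale /=.
  have -> : 1 + (r^-1 * t + - (a / r)) ^+ 2 = (r ^+ 2 + (t - a) ^+ 2) / r ^+ 2.
    by field; rewrite gt_eqF.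
  by field; rewrite !gt_eqF.
- move=> t _.
  have c1 : {for t, continuous (fun u : R => u - a)}.
    by apply: cvgB; [exact: cvg_id|exact: cvg_cst].
  have c2 : {for t, continuous (fun u : R => r ^+ 2 + (u - a) ^+ 2)}.
    by apply: cvgD; [exact: cvg_cst|exact: (continuousM c1 c1)].
  have c3 : {for t, continuous (fun u : R => (r ^+ 2 + (u - a) ^+ 2)^-1)}.
    by apply: continuousV => //; rewrite gt_eqF.
  by apply: cvgM; [exact: cvg_cst|exact: c3].
Qed.

(** Where [|t - b| <= r], the Cauchy kernel is at most 1 and the power is integrated explicitly.
    Elsewhere the power is at most [r ^ (e - 1)] and the kernel has integral at most [pi r]. The
    shift [del] keeps the base of the power positive, and the bound does not depend on it. *)
Lemma mollified_riesz_integral_le (e r del a b : R) :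
  0 < e <= 1 -> 0 < del -> del <= r ->
  (\int[mu]_t (if (-1 : R) <= t <= 1
     then r ^+ 2 / (r ^+ 2 + (t - a) ^+ 2) * (`|t - b| + del) `^ (e - 1) else 0)%:E
   <= ((4 / e + pi) * r `^ e)%:E)%E.
Proof.
move=> /andP[e0 e1] del0 delr; have r0 : 0 < r by exact: lt_le_trans delr.
(* [g1] and [g2] are the power to the left and to the right of [b] within distance [r], in affine
   form; [g3] is the truncated Cauchy kernel. *)
pose g1 (t : R) : R := if b - r <= t <= b then (-1 * t + (b + del)) `^ (e - 1) else 0.
pose g2 t : R := if b <= t <= b + r then (1 * t + (del - b)) `^ (e - 1) else 0.
pose g3 (t : R) : R := if -1 <= t <= 1 then r ^+ 2 / (r ^+ 2 + (t - a) ^+ 2) else 0.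
have q0 (t : R) : 0 < r ^+ 2 + (t - a) ^+ 2.
  by rewrite ltr_pwDl ?exprn_gt0 // sqr_ge0.
have k0 (t : R) : 0 <= r ^+ 2 / (r ^+ 2 + (t - a) ^+ 2).
  by rewrite divr_ge0 ?sqr_ge0 // ltW.
have k1 (t : R) : r ^+ 2 / (r ^+ 2 + (t - a) ^+ 2) <= 1.
  by rewrite ler_pdivrMr // mul1r lerDl sqr_ge0.
have mk := measurable_cauchy_kernel r a.
have mg1 : measurable_fun setT g1.
  apply: measurable_if_itv; apply: (measurableT_comp (measurable_powR (e - 1))).
  by apply: measurable_funD => //; apply: measurable_funM.
have mg2 : measurable_fun setT g2.
  apply: measurable_if_itv; apply: (measurableT_comp (measurable_powR (e - 1))).
  by apply: measurable_funD => //; apply: measurable_funM.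
have mg3 : measurable_fun setT g3 by exact: measurable_if_itv.
have g10 t : 0 <= g1 t by rewrite /g1; case: ifP => // _; exact: powR_ge0.
have g20 t : 0 <= g2 t by rewrite /g2; case: ifP => // _; exact: powR_ge0.
have g30 t : 0 <= g3 t by rewrite /g3; case: ifP.
have re0 : 0 <= r `^ (e - 1) by exact: powR_ge0.
apply: (@le_trans _ _ (\int[mu]_t ((g1 t)%:E + (g2 t)%:E + (r `^ (e - 1))%:E * (g3 t)%:E))%E).
  apply: ge0_le_integral => //.
  - by move=> t _; case: ifP => // _; rewrite lee_fin mulr_ge0 // powR_ge0.
  - apply/measurable_EFinP; apply: measurable_if_itv; apply: measurable_funM => //.
    apply: (measurableT_comp (measurable_powR (e - 1))).
    apply: measurable_funD => //; apply: measurableT_comp => //.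
    exact: measurable_funB.
  - by apply/measurable_EFinP; apply: measurable_funD; [exact: measurable_funD|exact: measurable_funM].
  - move=> t _; rewrite -EFinM -!EFinD lee_fin.
    rewrite /g3; case: ifP => [tI|_]; last by rewrite mulr0 addr0 addr_ge0.
    have [tbr|tbr] := leP `|t - b| r.
    + apply: (@le_trans _ _ (g1 t + g2 t)); last by rewrite lerDl mulr_ge0.
      apply: le_trans (ler_piMl (powR_ge0 _ _) (k1 t)) _.
      move: tbr; rewrite ler_norml => /andP[tb1 tb2].
      have [tb|tb] := leP t b.
        rewrite /g1 (_ : b - r <= t <= b) ?tb ?andbT; last by lra.
        rewrite ler0_norm ?subr_le0 // (_ : - (t - b) + del = -1 * t + (b + del)).
          by rewrite lerDl.
        by ring.
      rewrite /g2 (_ : b <= t <= b + r); last by apply/andP; split; lra.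
      rewrite ger0_norm ?subr_ge0 ?(ltW tb) // (_ : t - b + del = 1 * t + (del - b)).
        by rewrite lerDr.
      by ring.
    + rewrite mulrC ler_wpDl ?addr_ge0 // ler_wpM2r //.
      rewrite -[e - 1]opprB !powRN lef_pV2 ?posrE ?powR_gt0 //; last by rewrite ltr_wpDl.
      rewrite ge0_ler_powR ?nnegrE ?subr_ge0 ?(ltW r0) ?addr_ge0 ?(ltW del0) //.
      by rewrite (le_trans (ltW tbr)) // lerDl ltW.
have eg (g : R -> R) : (forall t, 0 <= g t) -> forall t, @classical_sets.setT R t -> (0 <= (g t)%:E)%E.
  by move=> g0 t _; rewrite lee_fin.
have em (g : R -> R) : measurable_fun setT g -> measurable_fun setT (EFin \o g).
  by move=> mg; apply/measurable_EFinP.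
have g12 t : 0 <= g1 t + g2 t by rewrite addr_ge0.
have rg3 t : 0 <= r `^ (e - 1) * g3 t by rewrite mulr_ge0.
have mg12 : measurable_fun setT (fun t => g1 t + g2 t) by exact: measurable_funD.
have mrg3 : measurable_fun setT (fun t => r `^ (e - 1) * g3 t).
  exact: measurable_funM.
rewrite (ge0_integralD mu measurableT (eg _ g12) (em _ mg12) (eg _ rg3) (em _ mrg3)).
rewrite (ge0_integralD mu measurableT (eg _ g10) (em _ mg1) (eg _ g20) (em _ mg2)).
rewrite (ge0_integralZl_EFin mu measurableT (eg _ g30) (em _ mg3) re0).
(* Here [del <= r] and [2 ^ e <= 2] are used; this is what makes the bound uniform in [del]. *)
have p2r : (r + del) `^ e <= 2 * r `^ e.
  apply: (@le_trans _ _ ((2 * r) `^ e)).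
    by rewrite ge0_ler_powR ?nnegrE ?(ltW e0) ?addr_ge0 ?mulr_ge0 ?(ltW r0) ?(ltW del0) //; lra.
  rewrite powRM ?(ltW r0) // ler_wpM2r ?powR_ge0 //.
  by rewrite -[leRHS]powRr1 // ler_powR // ler1n.
have I1 : (\int[mu]_t (g1 t)%:E <= (2 / e * r `^ e)%:E)%E.
  rewrite powR_affine_integral //; last 2 first.
  - by rewrite ltrBlDr ltrDl.
  - by move=> t /andP[? ?]; lra.
  rewrite lee_fin (_ : -1 * b + (b + del) = del); last by ring.
  rewrite (_ : -1 * (b - r) + (b + del) = r + del); last by ring.
  rewrite mulN1r invrN mulrN -mulNr opprB mulrAC ler_pM2r ?invr_gt0 //.
  by have := powR_ge0 del e; lra.
have I2 : (\int[mu]_t (g2 t)%:E <= (2 / e * r `^ e)%:E)%E.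
  rewrite powR_affine_integral //; last 2 first.
  - by rewrite ltrDl.
  - by move=> t /andP[? ?]; lra.
  rewrite lee_fin (_ : 1 * b + (del - b) = del); last by ring.
  rewrite (_ : 1 * (b + r) + (del - b) = r + del); last by ring.
  rewrite mul1r mulrAC ler_pM2r ?invr_gt0 //.
  by have := powR_ge0 del e; lra.
have I3 := cauchy_kernel_integral_le r a r0.
apply: (@le_trans _ _ ((2 / e * r `^ e)%:E + (2 / e * r `^ e)%:E
   + (r `^ (e - 1))%:E * (pi * r)%:E)%E).
  by apply: leeD; [exact: leeD|exact: lee_wpmul2l].
rewrite -EFinM -!EFinD lee_fin.
have -> : r `^ (e - 1) * (pi * r) = pi * r `^ e.
  rewrite mulrCA; congr (_ * _).
  rewrite -[X in _ * X = _]powRr1 ?(ltW r0) // -powRD ?subrK //.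
  by rewrite gt_eqF // implybT.
by rewrite le_eqVlt; apply/orP; left; apply/eqP; field; rewrite gt_eqF.
Qed.

End OneDimensional.

(** * The divergence identity and its two sides *)

Section DivergenceInequality.
Context {R : realType} {d n : nat}.
Variables (xs : 'I_n -> 'rV[R]_d) (alpha r : 'I_n -> R).
Hypothesis (d_gt0 : (0 < d)%N).
Hypothesis xs1 : forall k, enorm (xs k) = 1.
Hypothesis alpha_gt0 : forall k, 0 < alpha k.
Hypothesis r_gt0 : forall k, 0 < r k.
Implicit Types x : 'rV[R]_d.

Local Notation rho k x := (enorm (xs k - x)).
Local Notation q k x := (r k ^+ 2 + rho k x ^+ 2).

Definition bump k x : R := (r k ^+ 2 / q k x) ^+ d.
(** Names with a leading [d] are the partial derivatives in the [i]-th coordinate; [dfield i] and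
    [dflux s i] differentiate the [i]-th component of the vector field, so their sums over [i] are
    divergences. *)
Definition dbump k i x : R := 2 * d%:R * bump k x * (xs k - x) ord0 i / q k x.
Definition bumps x : R := \sum_(k < n) bump k x.
Definition cutoff x : R := 1 - (1 + bumps x)^-1.
Definition dcutoff i x : R := (\sum_(k < n) dbump k i x) / (1 + bumps x) ^+ 2.
Definition dfield i x : R := \sum_(k < n)
  alpha k * (d%:R * (xs k - x) ord0 i ^+ 2 / (rho k x ^+ d * rho k x ^+ 2)
             - (rho k x ^+ d)^-1).
Definition eta (s : R) x : R := s ^+ 2 - enorm x ^+ 2.
Definition flux s i x : R := eta s x * cutoff x * field_sum xs alpha x ord0 i.
Definition dflux s i x : R :=
  eta s x * cutoff x * dfield i x
  + field_sum xs alpha x ord0 i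
    * (eta s x * dcutoff i x + cutoff x * (- 2 * x ord0 i)).
Definition poisson_part x : R :=
  cutoff x * \sum_(k < n) alpha k * ((1 - enorm x ^+ 2) / rho k x ^+ d).
Definition riesz_part x : R :=
  cutoff x * \sum_(k < n) alpha k * (rho k x ^+ 2 / rho k x ^+ d).

Lemma field_sumE x i : field_sum xs alpha x ord0 i =
  \sum_(k < n) alpha k * ((xs k - x) ord0 i * (rho k x ^+ d)^-1).
Proof.
rewrite /field_sum summxE; apply: eq_bigr => k _; rewrite mxE; ring.
Qed.

Lemma q_gt0 k x : 0 < q k x.
Proof. by rewrite ltr_pwDl ?exprn_gt0 // exprn_ge0 // enorm_ge0. Qed.

Lemma bump_gt0 k x : 0 < bump k x.
Proof. by rewrite exprn_gt0 // divr_gt0 ?exprn_gt0 // q_gt0. Qed.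

Lemma bumps_ge0 x : 0 <= bumps x.
Proof. by apply: sumr_ge0 => k _; rewrite ltW // bump_gt0. Qed.

Lemma bumpsD1_gt0 x : 0 < 1 + bumps x.
Proof. by rewrite ltr_pwDl // bumps_ge0. Qed.

Lemma cutoffE x : cutoff x = bumps x / (1 + bumps x).
Proof. by rewrite /cutoff; field; rewrite gt_eqF // bumpsD1_gt0. Qed.

Lemma cutoff_ge0 x : 0 <= cutoff x.
Proof. by rewrite cutoffE divr_ge0 ?bumps_ge0 // ltW // bumpsD1_gt0. Qed.

Lemma cutoff_le x : cutoff x <= bumps x.
Proof.
by rewrite cutoffE ler_pdivrMr ?bumpsD1_gt0 // ler_peMr ?bumps_ge0 // lerDl bumps_ge0.
Qed.

Lemma sphere_dist_ge k x : 1 - enorm x <= rho k x.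
Proof. by rewrite -(xs1 k) enorm_sub_ge. Qed.

Lemma rho_gt0 k x : enorm x < 1 -> 0 < rho k x.
Proof. by move=> x1; apply: lt_le_trans (sphere_dist_ge k x); rewrite subr_gt0. Qed.

(** * Partial derivatives of the cutoff, the field and the flux *)

Lemma pder_xsB k x i j : pder (fun v => (xs k - v) ord0 j) x i (- (i == j)%:R).
Proof.
rewrite (_ : (fun v => _) = (fun v : 'rV[R]_d => xs k ord0 j + - v ord0 j)); last first.
  by apply/funext => v; rewrite !mxE.
apply: pder_eq (pderD _ _ _ _ _ _ (pder_cst _ _ _) (pderN _ _ _ _ (pder_coord _ _ _))) _.
by rewrite add0r.
Qed.

Lemma sum_coord_delta (f : 'I_d -> R) i : \sum_(j < d) f j * (i == j)%:R = f i.
Proof.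
rewrite (bigD1 i) //= eqxx mulr1 big1 ?addr0 // => j /negbTE ji.
by rewrite eq_sym ji mulr0.
Qed.

Lemma pder_sqr_rho k x i :
  pder (fun v => rho k v ^+ 2) x i (- 2 * (xs k - x) ord0 i).
Proof.
rewrite (_ : (fun v => _) = (fun v : 'rV[R]_d => \sum_(j < d) (xs k - v) ord0 j ^+ 2)); last first.
  by apply/funext => v; rewrite sqr_enorm.
apply: pder_eq (pder_sum _ _ _ _ _ (fun j => pderX 2 _ _ _ _ (pder_xsB k x i j))) _.
rewrite (eq_bigr (fun j => (- 2 * (xs k - x) ord0 j) * (i == j)%:R)).
  exact: sum_coord_delta.
by move=> j _ /=; rewrite expr1; ring.
Qed.

Lemma pder_sqr_enorm x i :
  pder (fun v => enorm v ^+ 2) x i (2 * x ord0 i).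
Proof.
rewrite (_ : (fun v => _) = (fun v : 'rV[R]_d => \sum_(j < d) v ord0 j ^+ 2)); last first.
  by apply/funext => v; rewrite sqr_enorm.
apply: pder_eq (pder_sum _ _ _ _ _ (fun j => pderX 2 _ _ _ _ (pder_coord x i j))) _.
rewrite (eq_bigr (fun j => (2 * x ord0 j) * (i == j)%:R)).
  exact: sum_coord_delta.
by move=> j _ /=; rewrite expr1; ring.
Qed.

(** The distance is differentiated as the square root of its square, which is legitimate away from
    the pole. *)
Lemma pder_rho k x i : 0 < rho k x ->
  pder (fun v => rho k v) x i (- (xs k - x) ord0 i / rho k x).
Proof.
move=> rx0.
have := pder_sqrt (fun v => rho k v ^+ 2) x i _ (exprn_gt0 _ rx0) (pder_sqr_rho k x i).
rewrite (_ : (fun v => _) = (fun v : 'rV[R]_d => rho k v)); last first.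
  by apply/funext => v; rewrite sqrtr_sqr ger0_norm // enorm_ge0.
move/pder_eq; apply; rewrite sqrtr_sqr ger0_norm ?enorm_ge0 //.
by field; rewrite gt_eqF.
Qed.

Lemma pder_rhoV k x i : 0 < rho k x ->
  pder (fun v => (rho k v ^+ d)^-1) x i
    (d%:R * (xs k - x) ord0 i / (rho k x ^+ d * rho k x ^+ 2)).
Proof.
move=> rx0.
have h := pderV _ _ _ _ _ (pderX d _ _ _ _ (pder_rho k x i rx0)).
apply: pder_eq (h _) _; first by rewrite gt_eqF // exprn_gt0.
have -> : rho k x ^+ d = rho k x ^+ d.-1 * rho k x by rewrite -exprSr prednK.
by field; rewrite gt_eqF // gt_eqF // exprn_gt0.
Qed.

Lemma pder_field i x : enorm x < 1 ->
  pder (fun v => field_sum xs alpha v ord0 i) x i (dfield i x).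
Proof.
move=> x1.
rewrite (_ : (fun v => _) = (fun v : 'rV[R]_d => \sum_(k < n)
  alpha k * ((xs k - v) ord0 i * (rho k v ^+ d)^-1))); last first.
  by apply/funext => v; rewrite field_sumE.
have h k := pderM _ _ _ _ _ _ (pder_cst x i (alpha k))
  (pderM _ _ _ _ _ _ (pder_xsB k x i i) (pder_rhoV k x i (rho_gt0 k x x1))).
apply: pder_eq (pder_sum _ _ _ _ _ h) _; apply: eq_bigr => k _ /=.
rewrite eqxx mulr0 addr0; congr (_ * _).
by rewrite /= -mulr_natr; ring.
Qed.

Lemma pder_bump k i x : pder (bump k) x i (dbump k i x).
Proof.
have q0 := q_gt0 k x.
have h1 := pderD _ _ _ _ _ _ (pder_cst x i (r k ^+ 2)) (pder_sqr_rho k x i).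
have h2 := pderV _ _ _ _ (negbT (gt_eqF q0)) h1.
have h3 := pderX d _ _ _ _ (pderM _ _ _ _ _ _ (pder_cst x i (r k ^+ 2)) h2).
apply: pder_eq h3 _; rewrite /dbump /bump /=.
have -> : (r k ^+ 2 / q k x) ^+ d = (r k ^+ 2 / q k x) ^+ d.-1 * (r k ^+ 2 / q k x).
  by rewrite -exprSr prednK.
by field; rewrite gt_eqF.
Qed.

Lemma pder_cutoff i x : pder cutoff x i (dcutoff i x).
Proof.
have h := pderD _ _ _ _ _ _ (pder_cst x i (1 : R))
  (pder_sum _ _ _ _ _ (fun k => pder_bump k i x)).
have h2 := pderV _ _ _ _ (negbT (gt_eqF (bumpsD1_gt0 x))) h.
apply: pder_eq (pderD _ _ _ _ _ _ (pder_cst x i (1 : R)) (pderN _ _ _ _ h2)) _.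
by rewrite /dcutoff /bumps; ring.
Qed.

Lemma pder_flux s i x : enorm x < 1 -> pder (flux s i) x i (dflux s i x).
Proof.
move=> x1.
have h1 := pderD _ _ _ _ _ _ (pder_cst x i (s ^+ 2))
  (pderN _ _ _ _ (pder_sqr_enorm x i)).
have h2 := pderM _ _ _ _ _ _ (pderM _ _ _ _ _ _ h1 (pder_cutoff i x))
  (pder_field i x x1).
by apply: pder_eq h2 _; rewrite /dflux /eta; ring.
Qed.

(** For each [k] the squares of the coordinates of [x_k - x] add up to [rho ^ 2], so the first terms
    sum to [d / rho ^ d] and cancel the [d] copies of [1 / rho ^ d]. *)
Lemma div_field0 x : enorm x < 1 -> \sum_(i < d) dfield i x = 0.
Proof.
move=> x1; rewrite exchange_big /= big1 // => k _.
have rx0 := rho_gt0 k x x1.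
rewrite -mulr_sumr sumrB sumr_const card_ord -mulr_suml -mulr_sumr -sqr_enorm.
rewrite -[_ *+ d]mulr_natl.
by field; rewrite !gt_eqF ?exprn_gt0.
Qed.

(** Since [|x_k| = 1], polarisation gives [2 x . (x_k - x) = 1 - |x| ^ 2 - |x_k - x| ^ 2]. *)
Lemma field_radial x :
  2 * (\sum_(i < d) x ord0 i * field_sum xs alpha x ord0 i) =
  \sum_(k < n) alpha k * ((1 - enorm x ^+ 2) / rho k x ^+ d) -
  \sum_(k < n) alpha k * (rho k x ^+ 2 / rho k x ^+ d).
Proof.
under eq_bigr do rewrite field_sumE mulr_sumr.
rewrite exchange_big mulr_sumr -sumrB; apply: eq_bigr => k _.
have -> : \sum_(i < d) x ord0 i * (alpha k * ((xs k - x) ord0 i * (rho k x ^+ d)^-1))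
  = alpha k * (rho k x ^+ d)^-1 * \sum_(i < d) x ord0 i * (xs k - x) ord0 i.
  by rewrite mulr_sumr; apply: eq_bigr => i _; ring.
suff -> : \sum_(i < d) x ord0 i * (xs k - x) ord0 i =
  (1 - enorm x ^+ 2 - rho k x ^+ 2) / 2 by lra.
transitivity ((enorm (xs k) ^+ 2 - enorm x ^+ 2 - rho k x ^+ 2) / 2); last first.
  by rewrite xs1 expr1n.
rewrite !sqr_enorm -!sumrB mulr_suml; apply: eq_bigr => i _.
by rewrite !mxE; field.
Qed.

Lemma eta_dcutoff_le s i x : 0 <= s <= 1 -> enorm x <= s ->
  `|eta s x * dcutoff i x| <= 4 * d%:R.
Proof.
move=> /andP[s0 s1] xs_.
have x0 := enorm_ge0 x.
have eta0 : 0 <= eta s x by rewrite subr_ge0 ler_pXn2r ?nnegrE.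
(* [eta] factors as [(s - |x|) (s + |x|)], where the second factor is at most 2 and the first at
   most [1 - |x| <= rho k x]. *)
have etak k : eta s x <= 2 * rho k x.
  have := sphere_dist_ge k x; rewrite /eta; nra.
have dk k : `|eta s x * dbump k i x| <= 4 * d%:R * bump k x.
  have q0 := q_gt0 k x; have b0 := bump_gt0 k x.
  rewrite /dbump !normrM (ger0_norm eta0) (ger0_norm (ltW b0)).
  rewrite (ger0_norm (_ : 0 <= 2)) // (ger0_norm (ler0n _ d)).
  rewrite (gtr0_norm (_ : 0 < (q k x)^-1)) ?invr_gt0 //.
  rewrite !mulrA ler_pdivrMr //.
  apply: (@le_trans _ _ (2 * rho k x * 2 * d%:R * bump k x * rho k x)).
    rewrite !ler_pM ?mulr_ge0 ?(ltW b0) ?normr_coord_le //.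
  rewrite (_ : _ * rho k x = 4 * d%:R * bump k x * rho k x ^+ 2); last by ring.
  by rewrite ler_wpM2l ?mulr_ge0 ?(ltW b0) // lerDr exprn_ge0 // ltW.
have H0 := bumps_ge0 x; have H1 := bumpsD1_gt0 x.
rewrite /dcutoff mulrA normrM (gtr0_norm (_ : 0 < ((1 + bumps x) ^+ 2)^-1));
  last by rewrite invr_gt0 exprn_gt0.
rewrite ler_pdivrMr ?exprn_gt0 // mulr_sumr.
apply: le_trans (ler_norm_sum _ _ _) _.
apply: (@le_trans _ _ (\sum_(k < n) 4 * d%:R * bump k x)); first exact: ler_sum.
rewrite -mulr_sumr ler_wpM2l ?mulr_ge0 //.
(* The sum of the bumps is absorbed by the denominator: [H <= (1 + H) ^ 2]. Hence the bound does not
   depend on [n] or on the radii. *)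
by rewrite -/(bumps x); nra.
Qed.

(** By the product rule, [div flux] is [eta cutoff div F + F . (eta grad cutoff) - cutoff 2 (x .
    F)]; the first term vanishes and the last one is split by [field_radial]. *)
Lemma div_flux s x : enorm x < 1 ->
  poisson_part x + \sum_(i < d) dflux s i x =
  riesz_part x + \sum_(i < d) field_sum xs alpha x ord0 i * (eta s x * dcutoff i x).
Proof.
move=> x1.
have -> : \sum_(i < d) dflux s i x =
  eta s x * cutoff x * \sum_(i < d) dfield i x
  + \sum_(i < d) field_sum xs alpha x ord0 i * (eta s x * dcutoff i x)
  - cutoff x * (2 * \sum_(i < d) x ord0 i * field_sum xs alpha x ord0 i).
  rewrite !mulr_sumr -big_split -sumrB /=; apply: eq_bigr => i _.
  by rewrite /dflux; ring.
by rewrite div_field0 // field_radial /poisson_part /riesz_part; ring.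
Qed.

Lemma poisson_le_pointwise s x : 0 <= s < 1 -> enorm x <= s ->
  poisson_part x + \sum_(i < d) dflux s i x <=
  riesz_part x + 4 * d%:R ^+ 2 * enorm (field_sum xs alpha x).
Proof.
move=> /andP[s0 s1] xs_; rewrite div_flux ?(le_lt_trans xs_) // lerD2l.
apply: le_trans (ler_norm _) _; apply: le_trans (ler_norm_sum _ _ _) _.
apply: (@le_trans _ _ (\sum_(i < d) enorm (field_sum xs alpha x) * (4 * d%:R))).
  apply: ler_sum => i _; rewrite normrM ler_pM ?normr_coord_le //.
  by apply: eta_dcutoff_le => //; rewrite s0 ltW.
by rewrite sumr_const card_ord -mulr_natr le_eqVlt; apply/orP; left; apply/eqP; ring.
Qed.

(** * Regularity of the integrands on balls of radius less than 1 *)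

Lemma tame_xsB s k i : tame s (fun x => (xs k - x) ord0 i).
Proof.
rewrite (_ : (fun v => _) = (fun v : 'rV[R]_d => xs k ord0 i + - v ord0 i)); last first.
  by apply/funext => v; rewrite !mxE.
by apply: tameD; [exact: tame_cst|exact/tameN/tame_coord].
Qed.

Lemma tame_rho s k : tame s (fun x => rho k x).
Proof.
apply: tame_sqrt; first by move=> x; exact: sumsq_ge0.
by apply: tame_sum => i; exact/tameX/tame_xsB.
Qed.

(** On the ball of radius [s] the poles stay at distance at least [1 - s]. *)
Lemma tame_rhoV s k m : s < 1 -> tame s (fun x => (rho k x ^+ m)^-1).
Proof.
move=> s1; have s10 : 0 < 1 - s by rewrite subr_gt0.
apply: (tameV s ((1 - s) ^+ m)); first by rewrite exprn_gt0.
- by move=> x; rewrite exprn_ge0 // enorm_ge0.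
- move=> x xs_; rewrite lerXn2r ?nnegrE ?enorm_ge0 ?(ltW s10) //.
  by apply: le_trans (sphere_dist_ge k x); rewrite lerB.
- exact/tameX/tame_rho.
Qed.

Lemma tame_qV s k : tame s (fun x => (q k x)^-1).
Proof.
apply: (tameV s (r k ^+ 2)); first by rewrite exprn_gt0.
- by move=> x; rewrite ltW // q_gt0.
- by move=> x _; rewrite lerDl exprn_ge0 // enorm_ge0.
- by apply: tameD; [exact: tame_cst|exact/tameX/tame_rho].
Qed.

Lemma tame_bump s k : tame s (bump k).
Proof.
by apply: tameX; apply: tameM; [exact: tame_cst|exact: tame_qV].
Qed.

Lemma tame_bumpsD1V s : tame s (fun x => (1 + bumps x)^-1).
Proof.
apply: (tameV s 1) => //.
- by move=> x; rewrite ltW // bumpsD1_gt0.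
- by move=> x _; rewrite lerDl bumps_ge0.
- by apply: tameD; [exact: tame_cst|apply: tame_sum => k; exact: tame_bump].
Qed.

Lemma tame_cutoff s : tame s cutoff.
Proof. by apply: tameD; [exact: tame_cst|exact/tameN/tame_bumpsD1V]. Qed.

Lemma tame_field s i : s < 1 -> tame s (fun x => field_sum xs alpha x ord0 i).
Proof.
move=> s1; under eq_fun do rewrite field_sumE.
apply: tame_sum => k; apply: tameM; first exact: tame_cst.
by apply: tameM; [exact: tame_xsB|exact: tame_rhoV].
Qed.

Lemma tame_dfield s i : s < 1 -> tame s (dfield i).
Proof.
move=> s1; rewrite /dfield; apply: tame_sum => k; apply: tameM; first exact: tame_cst.
apply: tameD; last exact/tameN/tame_rhoV.
apply: tameM; first by apply: tameM; [exact: tame_cst|exact/tameX/tame_xsB].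
by under eq_fun do rewrite -exprD; exact: tame_rhoV.
Qed.

Lemma tame_sqr_enorm s : tame s (fun x => enorm x ^+ 2).
Proof.
by under eq_fun do rewrite sqr_enorm; apply: tame_sum => i; exact/tameX/tame_coord.
Qed.

Lemma tame_dcutoff s i : tame s (dcutoff i).
Proof.
apply: tameM; last first.
  by under eq_fun do rewrite -exprVn; exact/tameX/tame_bumpsD1V.
apply: tame_sum => k; apply: tameM; last exact: tame_qV.
apply: tameM; last exact: tame_xsB.
by apply: tameM; [exact: tame_cst|exact: tame_bump].
Qed.

Lemma tame_dflux s i : s < 1 -> tame s (dflux s i).
Proof.
move=> s1.
have teta : tame s (eta s).
  by apply: tameD; [exact: tame_cst|exact/tameN/tame_sqr_enorm].
apply: tameD; apply: tameM.
- by apply: tameM => //; exact: tame_cutoff.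
- exact: tame_dfield.
- exact: tame_field.
- apply: tameD; apply: tameM => //.
  + exact: tame_dcutoff.
  + exact: tame_cutoff.
  + by apply: tameM; [exact: tame_cst|exact: tame_coord].
Qed.

Lemma tame_riesz s : s < 1 -> tame s riesz_part.
Proof.
move=> s1; apply: tameM; first exact: tame_cutoff.
apply: tame_sum => k; apply: tameM; first exact: tame_cst.
by apply: tameM; [exact/tameX/tame_rho|exact: tame_rhoV].
Qed.

Lemma tame_poisson_term s k : s < 1 ->
  tame s (fun x => cutoff x * ((1 - enorm x ^+ 2) / rho k x ^+ d)).
Proof.
move=> s1; apply: tameM; first exact: tame_cutoff.
apply: tameM; last exact: tame_rhoV.
by apply: tameD; [exact: tame_cst|exact/tameN/tame_sqr_enorm].
Qed.

Lemma tame_poisson s : s < 1 -> tame s poisson_part.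
Proof.
move=> s1; rewrite /poisson_part.
under eq_fun do rewrite mulr_sumr; apply: tame_sum => k.
under eq_fun do rewrite mulrCA.
by apply: tameM; [exact: tame_cst|exact: tame_poisson_term].
Qed.

(** * Integration of the divergence identity over the ball of radius [s] *)

Local Notation "'\I' f" := (lebesgue_int_Rd (fun x => (f x)%:E))
  (at level 10, f at level 9).

Definition on_ball (s : R) (f : 'rV[R]_d -> R) x : R := if enorm x < s then f x else 0.

Lemma rmeas_on_ball s f : rmeas d f -> rmeas d (on_ball s f).
Proof.
move=> mf; apply: (rmeas_iflt d (@enorm R d) (fun=> s) f) => //.
by apply: rmeas_enorm => i; exact: rmeas_coord.
Qed.

Lemma on_ball_ge0 s f : (forall x, enorm x < s -> 0 <= f x) ->
  forall x, 0 <= on_ball s f x.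
Proof. by move=> f0 x; rewrite /on_ball; case: ifP => // /f0. Qed.

(** The ball lies in the cube of side 2, whose indicator is a product of functions of one
    coordinate. *)
Lemma rint_on_ball_fin s (c : R) : 0 <= c -> s <= 1 ->
  \I (on_ball s (fun=> c)) \is a fin_num.
Proof.
move=> c0 s1.
rewrite ge0_fin_numE; last first.
  by apply: lebesgue_int_Rd_ge0 => x; rewrite lee_fin; exact: on_ball_ge0.
pose g (i : 'I_d) (t : R) : R := if -1 <= t <= 1 then 1 else 0.
have g0 i t : 0 <= g i t by rewrite /g; case: ifP.
have mg i : measurable_fun setT (g i).
  by apply: measurable_if_itv; exact: measurable_cst.
have mp : rmeas d (fun x => \prod_(i < d) g i (x ord0 i)).
  by apply: rmeas_prod => i; apply: rmeas_comp => //; exact: rmeas_coord.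
apply: (@le_lt_trans _ _ (\I (fun x => c * \prod_(i < d) g i (x ord0 i)))).
  apply: le_rint.
  - exact: on_ball_ge0.
  - by apply: rmeas_on_ball; exact: rmeas_cst.
  - by apply: rmeasM => //; exact: rmeas_cst.
  - move=> x; rewrite /on_ball; case: ifP => [xs_|_]; last first.
      by rewrite mulr_ge0 // prodr_ge0.
    rewrite big1 ?mulr1 // => i _; rewrite /g -ler_norml.
    by rewrite (le_trans (normr_coord_le x i)) // (le_trans (ltW xs_)).
rewrite rintZ //; last by move=> x; exact: prodr_ge0.
rewrite (rint_prod_coord _ g (fun=> 2)) //; first by rewrite -EFinM ltry.
move=> i; rewrite integral_itv_indicator //; congr (_%:E); lra.
Qed.

(** This is the vanishing of the integral of [dflux s i], shifted by [M] so that both integrands are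
    nonnegative. It holds on every line in direction [i], because the factor [eta] of the flux
    vanishes on the sphere of radius [s]. *)
Lemma int_dflux s (M : R) i : 0 < s < 1 ->
  (forall x, enorm x <= s -> `|dflux s i x| <= M) ->
  \I (on_ball s (fun x => dflux s i x + M)) = \I (on_ball s (fun=> M)).
Proof.
move=> /andP[s0 s1] dM.
have M0 : 0 <= M.
  apply: le_trans (normr_ge0 _) (dM 0 _).
  by rewrite enorm0 ltW.
have [md _ _] := tame_dflux s i s1.
apply: (eq_lebesgue_int_Rd_lines d i).
- move=> x; rewrite lee_fin; apply: on_ball_ge0 => y ys.
  by have := dM _ (ltW ys); rewrite ler_norml => /andP[? _]; lra.
- by move=> x; rewrite lee_fin; apply: on_ball_ge0.
- by apply/rmeas_EFin/rmeas_on_ball/rmeasD => //; exact: rmeas_cst.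
- by apply/rmeas_EFin/rmeas_on_ball; exact: rmeas_cst.
move=> x; rewrite /on_ball (line_integral_pder s M (flux s i)) //; last 3 first.
- exact: tame_dflux.
- by move=> y ys; apply: pder_flux; exact: le_lt_trans s1.
- by move=> y ys; rewrite /flux /eta ys subrr !mul0r.
(* The same formula for the zero flux evaluates the right-hand side. *)
have := line_integral_pder s M (fun=> 0) (fun=> 0) x i s0 (tame_cst s 0)
  (fun y _ => pder_cst y i 0) (fun _ _ => erefl).
move=> <-; apply: eq_integral => t _; by rewrite add0r.
Qed.

Lemma riesz_part_ge0 x : 0 <= riesz_part x.
Proof.
rewrite mulr_ge0 ?cutoff_ge0 // sumr_ge0 // => k _.
by rewrite mulr_ge0 ?divr_ge0 ?exprn_ge0 ?enorm_ge0 // ltW.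
Qed.

Lemma poisson_term_ge0 k x : enorm x < 1 ->
  0 <= (1 - enorm x ^+ 2) / rho k x ^+ d.
Proof.
move=> x1; rewrite divr_ge0 ?exprn_ge0 ?enorm_ge0 // subr_ge0 exprn_ile1 ?enorm_ge0 //.
exact: ltW.
Qed.

Lemma poisson_part_ge0 x : enorm x < 1 -> 0 <= poisson_part x.
Proof.
move=> x1; rewrite mulr_ge0 ?cutoff_ge0 // sumr_ge0 // => k _.
by rewrite mulr_ge0 ?poisson_term_ge0 // ltW.
Qed.

Lemma rmeas_field : rmeas d (fun x => enorm (field_sum xs alpha x)).
Proof.
by apply: rmeas_enorm => i; case: (tame_field 0 i ltr01).
Qed.

(** The pointwise inequality is integrated after adding the constants [M i] to both sides; their
    integrals are finite and cancel by [int_dflux]. *)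
Lemma poisson_le_riesz_field s : 0 < s < 1 ->
  (\I (on_ball s poisson_part) <= \I (on_ball s riesz_part) +
    (4 * d%:R ^+ 2)%:E * \I (on_ball 1 (fun x => enorm (field_sum xs alpha x))))%E.
Proof.
move=> /andP[s0 s1].
have [M dM] : exists M : 'I_d -> R,
    forall i x, enorm x <= s -> `|dflux s i x| <= M i.
  have /fin_all_exists[M dM] : forall i, exists M : R,
      forall x, enorm x <= s -> `|dflux s i x| <= M.
    by move=> i; case: (tame_dflux s i s1).
  by exists M.
have M0 i : 0 <= M i.
  apply: le_trans (normr_ge0 _) (dM i 0 _).
  by rewrite enorm0 ltW.
have mP : rmeas d (on_ball s poisson_part).
  by apply: rmeas_on_ball; case: (tame_poisson s s1).
have mQ : rmeas d (on_ball s riesz_part).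
  by apply: rmeas_on_ball; case: (tame_riesz s s1).
have mE : rmeas d (on_ball 1 (fun x => enorm (field_sum xs alpha x))).
  exact/rmeas_on_ball/rmeas_field.
have mD i : rmeas d (on_ball s (fun x => dflux s i x + M i)).
  apply: rmeas_on_ball; apply: rmeasD; last exact: rmeas_cst.
  by case: (tame_dflux s i s1).
have mM i : rmeas d (on_ball s (fun=> M i)).
  by apply: rmeas_on_ball; exact: rmeas_cst.
have P0 x : 0 <= on_ball s poisson_part x.
  by apply: on_ball_ge0 => y ys; apply: poisson_part_ge0; exact: lt_trans s1.
have Q0 x : 0 <= on_ball s riesz_part x.
  by apply: on_ball_ge0 => y _; exact: riesz_part_ge0.
have E0 x : 0 <= on_ball 1 (fun x => enorm (field_sum xs alpha x)) x.
  by apply: on_ball_ge0 => y _; exact: enorm_ge0.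
have D0 i x : 0 <= on_ball s (fun x => dflux s i x + M i) x.
  apply: on_ball_ge0 => y ys.
  by have := dM i _ (ltW ys); rewrite ler_norml => /andP[? _]; lra.
have N0 i x : 0 <= on_ball s (fun=> M i) x by apply: on_ball_ge0.
have C0 : 0 <= 4 * d%:R ^+ 2 :> R by rewrite mulr_ge0 // exprn_ge0.
have Nfin : (\sum_(i < d) \I (on_ball s (fun=> M i)) \is a fin_num)%E.
  by apply/sum_fin_numP => i _ _; apply: rint_on_ball_fin => //; exact: ltW.
rewrite -(leeD2rE _ _ Nfin).
rewrite [X in (_ + X <= _)%E](eq_bigr (fun i => \I (on_ball s (fun x => dflux s i x + M i)))); last first.
  by move=> i _; rewrite (int_dflux s (M i)) ?s0 //; exact: dM.
rewrite -!rint_sum // -!rintZ // -!rintD //.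
- apply: le_rint.
  + by move=> x; rewrite addr_ge0 // sumr_ge0.
  + by apply: rmeasD => //; exact: rmeas_sum.
  + apply: rmeasD; last exact: rmeas_sum.
    by apply: rmeasD => //; apply: rmeasM => //; exact: rmeas_cst.
  + move=> x; rewrite /on_ball; case: ifP => xs_; last first.
      rewrite !big1 // !addr0 add0r mulr_ge0 //; case: ifP => // _.
      exact: enorm_ge0.
    rewrite (lt_trans xs_ s1) big_split /= addrA lerD2r.
    by apply: poisson_le_pointwise; rewrite ?(ltW xs_) ?(ltW s0).
all: try by move=> x; rewrite ?addr_ge0 ?mulr_ge0 // sumr_ge0.
all: try exact: rmeas_sum.
all: try (by apply: rmeasM => //; exact: rmeas_cst).
by apply: rmeasD => //; apply: rmeasM => //; exact: rmeas_cst.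
Qed.

(** * Lower bound for the Poisson part and upper bound for the Riesz part *)

Lemma cutoff_ge_half b k x : b <= 1 -> b <= bump k x -> b / 2 <= cutoff x.
Proof.
move=> b1 bk.
have bH : b <= bumps x.
  apply: le_trans bk _; rewrite /bumps (bigD1 k) //= lerDl.
  by apply: sumr_ge0 => j _; rewrite ltW // bump_gt0.
have H0 := bumps_ge0 x.
by rewrite cutoffE ler_pdivlMr ?bumpsD1_gt0 //; nra.
Qed.

(* The cube of half-side [r k / (4 d)] around [(1 - r k / 2) xs k] lies in the
   ball, and on it the integrand is of order [r k ^ (1 - d)]. *)
Lemma poisson_term_integral_ge s k : 0 < s < 1 -> r k <= 1 -> 1 - s < r k / 4 ->
  ((r k / (8 * (4 * d%:R) ^+ d))%:E <=
   \I (on_ball s (fun x => cutoff x * ((1 - enorm x ^+ 2) / rho k x ^+ d))))%E.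
Proof.
move=> /andP[s0 s1] r1 sr; have r0 := r_gt0 k.
have d0 : 0 < d%:R :> R by rewrite ltr0n.
pose z := (1 - r k / 2) *: xs k.
pose del := r k / (4 * d%:R).
have del0 : 0 < del by rewrite divr_gt0 // mulr_gt0.
pose g (i : 'I_d) (t : R) : R := if z ord0 i - del <= t <= z ord0 i + del then 1 else 0.
have g0 i t : 0 <= g i t by rewrite /g; case: ifP.
have mg i : measurable_fun setT (g i).
  by apply: measurable_if_itv; exact: measurable_cst.
have mp : rmeas d (fun x => \prod_(i < d) g i (x ord0 i)).
  by apply: rmeas_prod => i; apply: rmeas_comp => //; exact: rmeas_coord.
(* Lower bound of the integrand on the cube: the cutoff is at least [2 ^ (-d) / 2], [1 - |x| ^ 2] at
   least [r k / 4], and [rho] at most [r k]. Multiplied by the volume [(2 del) ^ d], it gives the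
   stated constant. *)
pose kap := (2^-1) ^+ d / 2 * (r k / 4 / r k ^+ d).
have kap0 : 0 <= kap by rewrite !mulr_ge0 ?invr_ge0 ?exprn_ge0 ?invr_ge0 // ltW.
have -> : (r k / (8 * (4 * d%:R) ^+ d))%:E = \I (fun x => kap * \prod_(i < d) g i (x ord0 i)).
  rewrite rintZ //; last by move=> x; exact: prodr_ge0.
  rewrite (rint_prod_coord _ g (fun=> 2 * del)) //; last first.
    move=> i; rewrite integral_itv_indicator; first by congr (_%:E); ring.
    by rewrite ltrD2l (lt_trans _ del0) // oppr_lt0.
  rewrite prodr_const card_ord -EFinM; congr (_%:E).
  have -> : 2 * del = (r k * 2) / (4 * d%:R) by rewrite /del; field; rewrite gt_eqF.
  rewrite expr_div_n [(r k * 2) ^+ d]exprMn /kap exprVn.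
  have : 0 < (2 : R) ^+ d by rewrite exprn_gt0.
  have : 0 < r k ^+ d by rewrite exprn_gt0.
  have : 0 < (4 * d%:R : R) ^+ d by rewrite exprn_gt0 // mulr_gt0.
  move: (2 ^+ d) (r k ^+ d) ((4 * d%:R) ^+ d) => A B C C0 B0 A0.
  by field; rewrite !gt_eqF.
apply: le_rint.
- by move=> x; rewrite mulr_ge0 // prodr_ge0.
- by apply: rmeasM => //; exact: rmeas_cst.
- by apply: rmeas_on_ball; case: (tame_poisson_term s k s1).
move=> x.
have [xz|] := boolP [forall i, z ord0 i - del <= x ord0 i <= z ord0 i + del]; last first.
  rewrite negb_forall => /existsP[i xi].
  rewrite (bigD1 i) //= {1}/g (negbTE xi) mul0r mulr0.
  apply: on_ball_ge0 => y ys; rewrite mulr_ge0 ?cutoff_ge0 // poisson_term_ge0 //.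
  exact: lt_trans s1.
rewrite big1 ?mulr1; last by move=> i _; rewrite /g (forallP xz i).
(* The Euclidean norm is at most the sum of the [d] coordinate distances, each at most [del]. *)
have xz4 : enorm (x - z) <= r k / 4.
  apply: le_trans (enorm_le_sum _) _.
  apply: (@le_trans _ _ (\sum_(i < d) del)).
    apply: ler_sum => i _; rewrite mxE [(- z) _ _]mxE ler_distl; exact: (forallP xz i).
  by rewrite sumr_const card_ord -mulr_natr /del le_eqVlt; apply/orP; left;
    apply/eqP; field; rewrite gt_eqF.
have ez : enorm z = 1 - r k / 2 by rewrite enormZ ?xs1 ?mulr1 //; lra.
have ekz : enorm (xs k - z) = r k / 2.
  have -> : xs k - z = (r k / 2) *: xs k.
    by rewrite /z scalerBl scale1r opprB addrC subrK.
  by rewrite enormZ ?xs1 ?mulr1 //; lra.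
have ex : enorm x <= 1 - r k / 4.
  have := enorm_sub_ge x z; lra.
have rhok : rho k x <= r k.
  have -> : xs k - x = (xs k - z) + (z - x) by rewrite addrA subrK.
  by apply: le_trans (enormD _ _) _; rewrite [enorm (z - x)]enormB ekz; lra.
have x0 := enorm_ge0 x.
rewrite /on_ball ifT; last by lra.
have rho0 : 0 < rho k x by apply: rho_gt0; lra.
rewrite /kap ler_pM //.
- by rewrite !mulr_ge0 ?invr_ge0 ?exprn_ge0 // ltW.
- apply: (cutoff_ge_half _ k); first by rewrite exprn_ile1 ?invr_ge0 // invf_le1 // ler1n.
  rewrite /bump lerXn2r ?nnegrE ?invr_ge0 // ?divr_ge0 ?sqr_ge0 ?(ltW (q_gt0 _ _)) //.
  rewrite ler_pdivlMr ?q_gt0 //.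
  have : rho k x ^+ 2 <= r k ^+ 2 by rewrite ler_pXn2r ?nnegrE ?enorm_ge0 ?(ltW r0).
  lra.
- apply: ler_pM.
  + by rewrite divr_ge0 // ltW.
  + by rewrite invr_ge0 exprn_ge0 // ltW.
  + nra.
  + by rewrite lef_pV2 ?posrE ?exprn_gt0 // lerXn2r ?nnegrE ?enorm_ge0 // ltW.
Qed.

Lemma poisson_integral_ge s : 0 < s < 1 ->
  (forall k, r k <= 1) -> (forall k, 1 - s < r k / 4) ->
  ((\sum_(k < n) alpha k * r k / (8 * (4 * d%:R) ^+ d))%:E <=
   \I (on_ball s poisson_part))%E.
Proof.
move=> s01 r1 sr; have /andP[s0 s1] := s01.
pose f k x := cutoff x * ((1 - enorm x ^+ 2) / rho k x ^+ d).
have mf k : rmeas d (on_ball s (f k)).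
  by apply: rmeas_on_ball; case: (tame_poisson_term s k s1).
have f0 k x : 0 <= on_ball s (f k) x.
  apply: on_ball_ge0 => y ys; rewrite mulr_ge0 ?cutoff_ge0 // poisson_term_ge0 //.
  exact: lt_trans s1.
have -> : \I (on_ball s poisson_part) = \I (fun x => \sum_(k < n) alpha k * on_ball s (f k) x).
  congr lebesgue_int_Rd; apply/funext => x; congr (_%:E); rewrite /on_ball.
  case: ifP => _; last by rewrite big1 // => k _; rewrite mulr0.
  by rewrite /poisson_part mulr_sumr; apply: eq_bigr => k _; rewrite /f; ring.
rewrite rint_sum; last 2 first.
- by move=> k x; rewrite mulr_ge0 // ltW.
- by move=> k; apply: rmeasM => //; exact: rmeas_cst.
rewrite -sumEFin; apply: lee_sum => k _.
rewrite rintZ ?(ltW (alpha_gt0 k)) // -mulrA EFinM.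
apply: lee_wpmul2l; first by rewrite lee_fin ltW.
exact: poisson_term_integral_ge.
Qed.

(* Both kernels are dominated by products of functions of one coordinate, the
   Riesz kernel through [|x| ^ (2 - d) <= \prod_i |x_i| ^ (2 / d - 1)]. *)
Lemma bump_le_prod k x :
  bump k x <= \prod_(i < d) (r k ^+ 2 / (r k ^+ 2 + (x ord0 i - xs k ord0 i) ^+ 2)).
Proof.
rewrite /bump -[X in _ ^+ X](card_ord d) -prodr_const.
apply: ler_prod => i _; rewrite divr_ge0 ?sqr_ge0 ?(ltW (q_gt0 _ _)) //=.
rewrite ler_pM2l ?exprn_gt0 // lef_pV2 ?posrE ?q_gt0 //; last first.
  by rewrite ltr_pwDl ?exprn_gt0 // sqr_ge0.
rewrite lerD2l -(real_normK (num_real _)) lerXn2r ?nnegrE ?enorm_ge0 //.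
by have := normr_coord_le (xs k - x) i; rewrite mxE [(- x) _ _]mxE distrC.
Qed.

Lemma riesz_le_prod s j x : (1 < d)%N -> s < 1 -> enorm x < s ->
  rho j x ^+ 2 / rho j x ^+ d <=
  2 ^+ d * \prod_(i < d) ((`|x ord0 i - xs j ord0 i| + (1 - s)) `^ (2 / d%:R - 1)).
Proof.
move=> d1 s1 xs_.
have d0 : 0 < d%:R :> R by rewrite ltr0n.
have rho0 : 0 < rho j x by apply: rho_gt0; exact: lt_trans s1.
have e0 : 0 <= 1 - 2 / d%:R :> R.
  by rewrite subr_ge0 ler_pdivrMr // mul1r ler_nat.
(* The exponent [2 - d] is shared equally among the [d] coordinates. *)
have -> : rho j x ^+ 2 / rho j x ^+ d = \prod_(i < d) (rho j x `^ (2 / d%:R - 1)).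
  rewrite prodr_const card_ord -[RHS]powR_mulrn ?powR_ge0 // -powRrM.
  rewrite mulrBl mul1r divfK ?gt_eqF // powRD ?(gt_eqF rho0) ?implybT //.
  by rewrite powRN !powR_mulrn // ltW.
rewrite -[X in 2 ^+ X](card_ord d) -prodr_const -big_split /=.
apply: ler_prod => i _; rewrite powR_ge0 /=.
set u := `|_| + _.
have u0 : 0 < u by rewrite ltr_wpDl // subr_gt0.
(* Both the coordinate distance and [1 - s] are at most [rho j x]; adding [1 - s] thus keeps the
   base positive at the cost of a factor 2. *)
have ur : u / 2 <= rho j x.
  have := sphere_dist_ge j x; have := normr_coord_le (xs j - x) i.
  rewrite mxE [(- x) _ _]mxE distrC /u; set w := `|_|; lra.
apply: (@le_trans _ _ ((u / 2) `^ (2 / d%:R - 1))).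
  rewrite -[2 / d%:R - 1]opprB !powRN lef_pV2 ?posrE ?powR_gt0 ?divr_gt0 //.
  by rewrite ge0_ler_powR ?nnegrE ?divr_ge0 ?(ltW u0) ?(ltW rho0).
(* Each coordinate loses [2 ^ (1 - 2 / d) <= 2], which accounts for the factor [2 ^ d]. *)
rewrite powRM ?(ltW u0) ?invr_ge0 // mulrC ler_wpM2r ?powR_ge0 //.
rewrite -[2 / d%:R - 1]opprB powRN -[2^-1]powR_inv1 // -powRrM mulN1r powRN invrK.
by rewrite -[leRHS]powRr1 // ler_powR ?ler1n ?gerBl ?divr_ge0 // ltW.
Qed.

(** With [cutoff <= bumps], each pair [(j, k)] is bounded by a product of [d] one-variable integrals
    with [e = 2 / d] and [del = 1 - s]. Each is at most a constant times [r k ^ (2 / d)], so the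
    product is of order [r k ^ 2], whatever [j] is. *)
Lemma riesz_integral_le s : (1 < d)%N -> 0 < s < 1 -> (forall k, 1 - s <= r k) ->
  (\I (on_ball s riesz_part) <=
   (2 ^+ d * (4 / (2 / d%:R) + pi) ^+ d * (\sum_(j < n) alpha j)
     * \sum_(k < n) r k ^+ 2)%:E)%E.
Proof.
move=> d1 /andP[s0 s1] sr.
have d0 : 0 < d%:R :> R by rewrite ltr0n.
pose e : R := 2 / d%:R.
have e01 : 0 < e <= 1.
  by rewrite divr_gt0 //= ler_pdivrMr // mul1r ler_nat.
pose g j k (i : 'I_d) (t : R) : R := if -1 <= t <= 1
  then r k ^+ 2 / (r k ^+ 2 + (t - xs k ord0 i) ^+ 2)
       * (`|t - xs j ord0 i| + (1 - s)) `^ (e - 1) else 0.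
have q0 k i (t : R) : 0 < r k ^+ 2 + (t - xs k ord0 i) ^+ 2.
  by rewrite ltr_pwDl ?exprn_gt0 // sqr_ge0.
have g0 j k i t : 0 <= g j k i t.
  rewrite /g; case: ifP => // _.
  by rewrite mulr_ge0 ?powR_ge0 // divr_ge0 ?sqr_ge0 // ltW.
have mg j k i : measurable_fun setT (g j k i).
  apply: measurable_if_itv; apply: measurable_funM.
    exact: measurable_cauchy_kernel.
  apply: (measurableT_comp (measurable_powR (e - 1))).
  apply: measurable_funD => //; apply: measurableT_comp => //.
  exact: measurable_funB.
pose G j k x := \prod_(i < d) g j k i (x ord0 i).
have G0 j k x : 0 <= G j k x by exact: prodr_ge0.
have mG j k : rmeas d (G j k).
  by apply: rmeas_prod => i; apply: rmeas_comp => //; exact: rmeas_coord.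
have aG0 j k x : 0 <= 2 ^+ d * alpha j * G j k x.
  by rewrite !mulr_ge0 ?exprn_ge0 // ltW.
have maG j k : rmeas d (fun x => 2 ^+ d * alpha j * G j k x).
  by apply: rmeasM => //; exact: rmeas_cst.
apply: (@le_trans _ _ (\I (fun x => \sum_(j < n) \sum_(k < n) 2 ^+ d * alpha j * G j k x))).
  apply: le_rint.
  - by apply: on_ball_ge0 => x _; exact: riesz_part_ge0.
  - by apply: rmeas_on_ball; case: (tame_riesz s s1).
  - by apply: rmeas_sum => j; exact: rmeas_sum.
  - move=> x; rewrite /on_ball; case: ifP => xs_; last first.
      by rewrite sumr_ge0 // => j _; rewrite sumr_ge0.
    rewrite /riesz_part mulr_sumr; apply: ler_sum => j _.
    have Z0 : 0 <= rho j x ^+ 2 / rho j x ^+ d.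
      by rewrite divr_ge0 ?exprn_ge0 ?enorm_ge0.
    apply: (@le_trans _ _ (bumps x * (alpha j * (rho j x ^+ 2 / rho j x ^+ d)))).
      by rewrite ler_wpM2r ?cutoff_le // mulr_ge0 // ltW.
    rewrite /bumps mulr_suml; apply: ler_sum => k _.
    rewrite mulrCA [leRHS](_ : _ = alpha j * (2 ^+ d * G j k x)); last by ring.
    rewrite ler_wpM2l ?(ltW (alpha_gt0 j)) //.
    have -> : G j k x = \prod_(i < d) (r k ^+ 2 / (r k ^+ 2 + (x ord0 i - xs k ord0 i) ^+ 2))
       * \prod_(i < d) ((`|x ord0 i - xs j ord0 i| + (1 - s)) `^ (2 / d%:R - 1)).
      rewrite -big_split; apply: eq_bigr => i _ /=; rewrite /g ifT //.
      rewrite -ler_norml (le_trans (normr_coord_le x i)) //.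
      by rewrite ltW // (lt_trans xs_).
    rewrite [leRHS]mulrCA; apply: ler_pM => //.
    + by rewrite ltW // bump_gt0.
    + exact: bump_le_prod.
    + exact: riesz_le_prod.
rewrite rint_sum; last 2 first.
- by move=> j x; exact: sumr_ge0.
- by move=> j; exact: rmeas_sum.
rewrite -!mulrA mulr_suml !mulr_sumr -sumEFin; apply: lee_sum => j _.
rewrite rint_sum // !mulr_sumr -sumEFin; apply: lee_sum => k _.
rewrite rintZ //; last by rewrite mulr_ge0 ?exprn_ge0 // ltW.
rewrite [leRHS](_ : _ = (2 ^+ d * alpha j * ((4 / e + pi) ^+ d * r k ^+ 2))%:E); last first.
  by congr (_%:E); rewrite -/e; ring.
rewrite [leRHS]EFinM; apply: lee_wpmul2l.
  by rewrite lee_fin mulr_ge0 ?exprn_ge0 // ltW.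
have -> : (4 / e + pi) ^+ d * r k ^+ 2 = ((4 / e + pi) * r k `^ e) ^+ d.
  rewrite exprMn; congr (_ * _).
  by rewrite -[RHS]powR_mulrn ?powR_ge0 // -powRrM /e divfK ?gt_eqF // powR_mulrn // ltW.
apply: rint_prod_coord_le => // i.
by apply: mollified_riesz_integral_le; rewrite ?subr_gt0.
Qed.

End DivergenceInequality.

(** * Weighted means and the choice of radii *)

Section WeightedMeans.
Context {R : realType} {n : nat}.
Variables (alpha : 'I_n -> R) (e : R).
Hypothesis alpha_gt0 : forall k, 0 < alpha k.
Hypothesis e01 : 0 <= e <= 1.

(** Dividing by [a ^ e b ^ e] leaves [b ^ (1 - e) <= a ^ (1 - e)]. *)
Lemma powR_swap_le (a b : R) : 0 < a -> 0 < b -> b <= a -> b * a `^ e <= a * b `^ e.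
Proof.
move=> a0 b0 ba; have /andP[e0 e1] := e01.
have split (c : R) : 0 < c -> c = c `^ e * c `^ (1 - e).
  move=> c0; rewrite -powRD ?(gt_eqF c0) ?implybT //.
  by rewrite addrC subrK powRr1 // ltW.
rewrite [X in X * _ <= _](split b) // [X in _ <= X * _](split a) //.
rewrite mulrAC [leRHS]mulrAC [_ `^ e * _]mulrC ler_wpM2l ?mulr_ge0 ?powR_ge0 //.
by rewrite ge0_ler_powR ?nnegrE ?subr_ge0 // ltW.
Qed.

(** Chebyshev's argument: the difference of the two sides is a double sum, and symmetrising it in
    [j] and [k] gives products of two factors of the same sign. *)
Lemma powR_mean_le :
  (\sum_(k < n) alpha k `^ (1 + e)) * \sum_(k < n) alpha k <=
  (\sum_(k < n) alpha k ^+ 2) * \sum_(k < n) alpha k `^ e.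
Proof.
have -> : \sum_(k < n) alpha k `^ (1 + e) = \sum_(k < n) alpha k * alpha k `^ e.
  apply: eq_bigr => k _; have a0 := alpha_gt0 k.
  by rewrite powRD ?(gt_eqF a0) ?implybT // powRr1 // ltW.
rewrite -subr_ge0 !mulr_suml.
under eq_bigr do rewrite mulr_sumr.
under [X in _ - X]eq_bigr do rewrite mulr_sumr.
rewrite -sumrB; under eq_bigr do rewrite -sumrB.
set f := fun j k => alpha j ^+ 2 * alpha k `^ e - alpha j * alpha j `^ e * alpha k.
rewrite -[X in 0 <= X]/(\sum_j \sum_k f j k).
have ff : 2 * (\sum_j \sum_k f j k) = \sum_j \sum_k (f j k + f k j).
  under [RHS]eq_bigr do rewrite big_split.
  by rewrite big_split /= [X in _ = _ + X]exchange_big /= mulrDl !mul1r.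
rewrite -(pmulr_rge0 _ (ltr0Sn R 1)) ff.
apply: sumr_ge0 => j _; apply: sumr_ge0 => k _.
have -> : f j k + f k j =
  (alpha j - alpha k) * (alpha j * alpha k `^ e - alpha k * alpha j `^ e).
  by rewrite /f; ring.
have [kj|jk] := leP (alpha k) (alpha j).
  by rewrite mulr_ge0 ?subr_ge0 // powR_swap_le.
by rewrite mulr_le0 ?subr_le0 ?(ltW jk) // powR_swap_le // ltW.
Qed.

End WeightedMeans.

(** The inverse of [1] plus the sum of the inverses is a witness that also covers the empty
    family. *)
Lemma pos_lower_bound (R : realType) (n : nat) (f : 'I_n -> R) :
  (forall k, 0 < f k) -> exists2 e : R, 0 < e <= 1 & forall k, e <= f k.
Proof.
move=> f0; have S0 : 0 <= \sum_(k < n) (f k)^-1.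
  by apply: sumr_ge0 => k _; rewrite invr_ge0 ltW.
exists (1 + \sum_(k < n) (f k)^-1)^-1.
  by rewrite invr_gt0 ltr_pwDl //= invf_le1 ?ltr_pwDl // lerDl.
move=> k; rewrite -[leRHS]invrK lef_pV2 ?posrE ?ltr_pwDl ?invr_gt0 //.
rewrite (bigD1 k) //= addrCA lerDl addr_ge0 // sumr_ge0 // => j _.
by rewrite invr_ge0 ltW.
Qed.

Theorem theorem1p1 (R : realType) (d : nat) (hd : (2 <= d)%N) :
  exists c : R, 0 < c /\
    forall (n : nat) (xs : 'I_n -> 'rV[R]_d) (alpha : 'I_n -> R),
      (forall k, enorm (xs k) = 1) ->
      (forall k, 0 < alpha k) ->
      ((c * (\sum_(k < n) alpha k `^ (1 + 2 / d%:R))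
           / (\sum_(k < n) alpha k `^ (2 / d%:R)))%:E
       <= lebesgue_int_Rd (fun x : 'rV[R]_d =>
            if in_open_ball x then (enorm (field_sum xs alpha x))%:E
            else 0%E))%E.
Proof.
have d_gt0 : (0 < d)%N by exact: leq_trans hd.
have d0 : 0 < d%:R :> R by rewrite ltr0n.
(* [c1] and [c2] are the constants of the Poisson and Riesz bounds. *)
pose c1 : R := (8 * (4 * d%:R) ^+ d)^-1.
have c10 : 0 < c1 by rewrite invr_gt0 mulr_gt0 // exprn_gt0 // mulr_gt0.
pose c2 : R := 2 ^+ d * (4 / (2 / d%:R) + pi) ^+ d.
have c20 : 0 < c2.
  by rewrite mulr_gt0 // exprn_gt0 // addr_gt0 ?pi_gt0 // divr_gt0 // divr_gt0.
(* Chosen so that [eps <= 1], which keeps the radii at most 1, and [eps * c2 <= c1 / 2], which lets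
   half of the Poisson part absorb the Riesz part. *)
pose eps : R := c1 / (2 * c2 + c1).
have den0 : 0 < 2 * c2 + c1 by rewrite addr_gt0 // mulr_gt0.
have eps0 : 0 < eps by rewrite divr_gt0.
have eps1 : eps <= 1 by rewrite ler_pdivrMr // mul1r lerDr mulr_ge0 // ltW.
have epsc : eps * c2 <= c1 / 2.
  by rewrite /eps mulrAC ler_pdivrMr //; nra.
pose K : R := 4 * d%:R ^+ 2.
have K0 : 0 < K by rewrite mulr_gt0 // exprn_gt0.
exists (c1 * eps / 2 / K); split; first by rewrite divr_gt0 // divr_gt0 // mulr_gt0.
move=> n xs alpha xs1 alpha0.
set J := lebesgue_int_Rd _.
have JE : J = lebesgue_int_Rd (fun x => (on_ball 1 (fun x => enorm (field_sum xs alpha x)) x)%:E).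
  congr lebesgue_int_Rd; apply/funext => x.
  by rewrite /on_ball /in_open_ball; case: ifP.
have J0 : (0 <= J)%E.
  rewrite JE; apply: lebesgue_int_Rd_ge0 => x; rewrite lee_fin.
  by apply: on_ball_ge0 => y _; exact: enorm_ge0.
(* Without points the left-hand side is [0]; otherwise the total weight can be divided by. *)
have [n0|n_gt0] := posnP n.
  by subst n; rewrite !big_ord0 mulr0 mul0r.
pose S := \sum_(k < n) alpha k.
have alphaS k : alpha k <= S.
  by rewrite /S (bigD1 k) //= lerDl sumr_ge0 // => j _; exact: ltW.
have S0 : 0 < S by exact: lt_le_trans (alpha0 (Ordinal n_gt0)) (alphaS _).
pose r k := eps * (alpha k / S).
have r0 k : 0 < r k by rewrite mulr_gt0 // divr_gt0.
have r1 k : r k <= 1.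
  have ak : alpha k / S <= 1 by rewrite ler_pdivrMr // mul1r.
  by apply: mulr_ile1; rewrite ?divr_ge0 // ltW.
have [e /andP[e0 e1] er] := pos_lower_bound R n (fun k => r k / 4) (fun k => divr_gt0 (r0 k) (ltr0Sn _ 3)).
(* One fixed [s] close enough to 1 suffices: [1 - s = e / 2] is below every [r k / 4], as both
   integral bounds require. *)
pose s := 1 - e / 2.
have s01 : 0 < s < 1 by rewrite /s; apply/andP; split; lra.
have main := poisson_le_riesz_field xs alpha r d_gt0 xs1 alpha0 r0 s s01.
have lower : ((\sum_(k < n) alpha k * r k / (8 * (4 * d%:R) ^+ d))%:E <= _)%E :=
  poisson_integral_ge xs alpha r d_gt0 xs1 alpha0 r0 s s01 r1 _.
have upper := riesz_integral_le xs alpha r d_gt0 xs1 alpha0 r0 s hd s01 _.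
pose T := \sum_(k < n) alpha k ^+ 2.
have T0 : 0 <= T by apply: sumr_ge0 => k _; exact: sqr_ge0.
(* With these radii, [\sum_k alpha_k r_k = eps T / S] and [\sum_k r_k ^ 2 = eps ^ 2 T / S ^ 2]. *)
have : ((c1 * eps * (T / S))%:E <= (c2 * S * (eps ^+ 2 * (T / S ^+ 2)))%:E + K%:E * J)%E.
  rewrite JE; apply: le_trans (le_trans main _).
  - rewrite [leLHS](_ : _ = (\sum_(k < n) alpha k * r k / (8 * (4 * d%:R) ^+ d))%:E).
      by apply: lower => k; have := er k; rewrite /s; lra.
    congr (_%:E); rewrite /T mulr_suml mulr_sumr; apply: eq_bigr => k _.
    by rewrite /r -/c1; ring.
  - apply: leeD => //; rewrite [leRHS](_ : _ = (c2 * S * \sum_(k < n) r k ^+ 2)%:E).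
      by apply: upper => k; have := er k; have := r0 k; rewrite /s; lra.
    congr (_%:E); congr (_ * _); rewrite /T mulr_suml mulr_sumr; apply: eq_bigr => k _.
    by rewrite /r; field; rewrite gt_eqF.
move: J0 {JE main lower upper}; case: J => [J||]; [|by move=> _ _; rewrite leey|by []].
rewrite !lee_fin => J0 main.
have mean : (\sum_(k < n) alpha k `^ (1 + 2 / d%:R)) / (\sum_(k < n) alpha k `^ (2 / d%:R))
   <= T / S.
  have P0 : 0 < \sum_(k < n) alpha k `^ (2 / d%:R).
    rewrite (bigD1 (Ordinal n_gt0)) //= ltr_pwDl ?powR_gt0 //.
    by apply: sumr_ge0 => k _; exact: powR_ge0.
  rewrite ler_pdivrMr // mulrAC ler_pdivlMr //.
  apply: powR_mean_le => //.
  by rewrite divr_ge0 ?(ltW d0) //= ler_pdivrMr // mul1r ler_nat.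
rewrite -mulrA; apply: (@le_trans _ _ (c1 * eps / 2 / K * (T / S))).
  by rewrite ler_wpM2l // !mulr_ge0 ?invr_ge0 // ltW.
rewrite -mulrA [K^-1 * _]mulrC mulrA ler_pdivrMr // [J * K]mulrC.
have TS0 : 0 <= T / S by rewrite divr_ge0 // ltW.
have e2 : c2 * S * (eps ^+ 2 * (T / S ^+ 2)) = (eps * c2) * eps * (T / S).
  by field; rewrite gt_eqF.
have : (eps * c2) * eps * (T / S) <= (c1 / 2) * eps * (T / S).
  by rewrite ler_wpM2r // ler_wpM2r // ltW.
(* The Riesz term is at most half of the left-hand side, so [K * J] is at least the other half. *)
move: main; rewrite e2; set X := (eps * c2) * _ * _; nra.
Qed.
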